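(* Let $m\geq 1$, let $V_1,\dots,V_m$ be two-dimensional vector spaces over $\mathbb{F}_2$, and let $W_k=\mathbb{F}_4\otimes_{\mathbb{F}_2}V_k$. The stabiliser group $G_{\mathcal{S}_{(m)}(2)}$ of the Segre variety $\mathcal{S}_{(m)}(2)$ has the following properties: 1. The union of the skew subspaces $\mathrm{span}\,\mathcal{B}_m^+$ and $\mathrm{span}\,\mathcal{B}_m^-$ is a $G_{\mathcal{S}_{(m)}(2)}$-invariant subset of $\mathbb{P}\big(\bigotimes_{k=1}^m W_k\big)$. 2. The union of the $2^{m-1}$ mutually skew real lines $$(\ast)\qquad \mathbb{F}_4U_{i}\vee\mathbb{F}_4U_{i'}\quad\text{with } i=(i_1,\dots,i_m)\in\{0,1\}^m,\ i_1=0,$$ is a $G_{\mathcal{S}_{(m)}(2)}$-invariant subset. The $3\cdot 2^{m-1}$ real points on these lines comprise an orbit of $G_{\mathcal{S}_{(m)}(2)}$. 3. If $m$ is even then $\mathrm{span}\,\mathcal{B}_m^+$ and $\mathrm{span}\,\mathcal{B}_m^-$ are real subspaces. Each of the lines from $(\ast)$ is contained in precisely one of them. 4. If $m$ is odd then $\mathrm{span}\,\mathcal{B}_m^+$ and $\mathrm{span}\,\mathcal{B}_m^-$ are complex-conjugate subspaces. Every line from $(\ast)$ meets each of $\mathrm{span}\,\mathcal{B}_m^+$ and $\mathrm{span}\,\mathcal{B}_m^-$ at precisely one point. 5. Every distinguished tangent of the Segre variety $\mathcal{S}_{(m)}(2)$ meets each of $\mathrm{span}\,\mathcal{B}_m^+$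 and $\mathrm{span}\,\mathcal{B}_m^-$ at precisely one point.
   Context: $\mathbb{P}(V)$ is the projective space of one-dimensional subspaces of $V$. The Segre variety is $\mathcal{S}_{(m)}(2)=\{\mathbb{F}_2(a_1\otimes\cdots\otimes a_m)\mid a_k\in V_k\setminus\{0\}\}\subset\mathbb{P}\big(\bigotimes_k V_k\big)=\mathrm{PG}(2^m-1,2)$; $G_{\mathcal{S}_{(m)}(2)}$ is the group of all elements of $\mathrm{PGL}\big(\bigotimes_k V_k\big)$ mapping it onto itself. $\mathbb{F}_4=\{0,1,\omega,\omega^2\}$ with $\omega^2+\omega+1=0$. We regard $V_k\subset W_k$ via $a\mapsto1\otimes a$, and identify $\mathbb{F}_4\otimes_{\mathbb{F}_2}\bigotimes_kV_k$ with $\bigotimes_kW_k$, so $\mathbb{P}(\bigotimes_kV_k)\subset\mathbb{P}(\bigotimes_kW_k)=\mathrm{PG}(2^m-1,4)$. Linear maps are extended $\mathbb{F}_4$-linearly, so $G_{\mathcal{S}_{(m)}(2)}$ acts on $\mathbb{P}(\bigotimes_kW_k)$. Complex conjugation on $\bigotimes_kW_k$ is the map induced by the Frobenius $z\mapsto z^2$ on $\mathbb{F}_4$ that fixes $\bigotimes_kV_k$ elementwise. A point is real if it lies in $\mathbb{P}(\bigotimes_kV_k)$; a subspace of $\mathbb{P}(\bigotimes_kW_k)$ is real if it equals its complex-conjugate subspace. A line of $\mathbb{P}(\bigotimes_kV_k)$ is identified with the real line of $\mathbb{P}(\bigotimes_kW_k)$ that it spans; a real line carries exactly three real points. $\vee$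 denotes the join of points, and spans are taken over $\mathbb{F}_4$. For each $k$ fix a basis $(e_0^{(k)},e_1^{(k)})$ of $V_k$ and put $u_0^{(k)}=e_0^{(k)}+\omega e_1^{(k)}$, $u_1^{(k)}=e_0^{(k)}+\omega^2e_1^{(k)}$. For $i\in\{0,1\}^m$ let $U_i=u_{i_1}^{(1)}\otimes\cdots\otimes u_{i_m}^{(m)}$. Let $i'$ be the opposite multi-index, i.e. $i'_k\ne i_k$ for all $k$. The invariant basis is $\mathcal{B}_m=\{\mathbb{F}_4U_i\mid i\in\{0,1\}^m\}$. $\mathcal{B}_m^+$ (resp. $\mathcal{B}_m^-$) is the set of those $\mathbb{F}_4U_i$ for which $i$ has an even (resp. odd) number of entries equal to $1$. Distinguished tangents: through each point $p=\mathbb{F}_2(a_1\otimes\cdots\otimes a_m)$ of $\mathcal{S}_{(m)}(2)$ there are exactly $m$ generators, namely the lines $\{\mathbb{F}_2(a_1\otimes\cdots\otimes a_{k-1}\otimes x\otimes a_{k+1}\otimes\cdots\otimes a_m)\mid x\in V_k\setminus\{0\}\}$, $k=1,\dots,m$. They span the ($m$-dimensional) tangent space at $p$; the tangent lines at $p$ are the lines of $\mathbb{P}(\bigotimes_kV_k)$ through $p$ contained in this tangent space. Precisely one of the $2^m-1$ tangent lines at $p$ does not lie in any of the $(m-1)$-dimensional subspaces spanned by $m-1$ of the generators through $p$; it is called the distinguished tangent at $p$. *)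

(* Defs.v *)
From HB Require Import structures.
From mathcomp Require Import all_boot all_order all_algebra all_field.

Set Implicit Arguments.
Unset Strict Implicit.
Unset Printing Implicit Defensive.
Import GRing.Theory.
Local Open Scope ring_scope.

(* A projective subspace of P(T) is a {vspace T}; its points are the
   one-dimensional subspaces that it contains, so the projective dimension is
   (\dim U).-1. A set of points of P(T) is a predicate on {vspace T}. *)
Section Projective.
Variables (K : fieldType) (T : vectType K).
Implicit Types (U A B p q : {vspace T}) (X : {vspace T} -> Prop).

Definition is_point p : Prop := \dim p = 1%N.
Definition is_line U : Prop := \dim U = 2%N.

Definition points U p : Prop := is_point p /\ (p <= U)%VS.

Definition points_union (s : seq {vspace T}) p : Prop :=
  exists2 U, U \in s & points U p.

Definition skew_subspaces A B : Prop := (A :&: B)%VS = 0%VS.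

Definition meets_at_one_point A B : Prop :=
  exists! p, points A p /\ points B p.

Definition maps_onto (f : 'End(T)) X : Prop :=
  forall q, X q <-> exists2 p, X p & q = (f @: p)%VS.

(* A group of collineations is a predicate [G] on the linear maps that
   represent its elements. *)
Definition is_invariant (G : 'End(T) -> Prop) X : Prop :=
  forall f, G f -> maps_onto f X.

Definition is_orbit (G : 'End(T) -> Prop) X : Prop :=
  exists2 p, is_point p &
    forall q, X q <-> exists2 f, G f & q = (f @: p)%VS.

Definition has_size X n : Prop :=
  exists2 s : seq {vspace T}, uniq s /\ size s = n & forall p, p \in s <-> X p.

End Projective.

(* Tensor products and extension of scalars, characterised by their universal
   properties. *)
Section Tensor.
Variables (K : fieldType) (m : nat) (V : 'I_m -> vectType K).

(* [dfwith a x], for [x : V k], is the family [a] with [a k] replaced by [x]. *)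
Definition multilinear (U : vectType K) (f : (forall k, V k) -> U) : Prop :=
  forall (a : forall k, V k) (k : 'I_m) (c : K) (x y : V k),
    f (dfwith (T := V) a (c *: x + y)) =
      c *: f (dfwith (T := V) a x) + f (dfwith (T := V) a y).

Definition is_tensor_product (T : vectType K) (t : (forall k, V k) -> T) : Prop :=
  multilinear t /\
  forall (U : vectType K) (f : (forall k, V k) -> U), multilinear f ->
    exists! g : 'Hom(T, U), forall a, g (t a) = f a.

End Tensor.

Section Scalars.
Variables (K : fieldType) (L : fieldExtType K).

Definition base_linear (V : vectType K) (U : vectType L) (f : V -> U) : Prop :=
  forall (c : K) (x y : V), f (c *: x + y) = (c%:A : L) *: f x + f y.

(* [iota] is the map [a |-> 1 (x) a] from V to W = L (x)_K V. *)
Definition is_scalar_extension (V : vectType K) (W : vectType L)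
    (iota : V -> W) : Prop :=
  base_linear iota /\
  forall (U : vectType L) (f : V -> U), base_linear f ->
    exists! g : 'Hom(W, U), forall v, g (iota v) = f v.

(* The embedding [j] of the tensor product of the V k over K into that of
   the W k = L (x)_K (V k) over L; it is determined by these two conditions. *)
Definition is_tensor_embedding (m : nat)
    (V : 'I_m -> vectType K) (W : 'I_m -> vectType L)
    (iota : forall k, V k -> W k)
    (TV : vectType K) (tV : (forall k, V k) -> TV)
    (TW : vectType L) (tW : (forall k, W k) -> TW) (j : TV -> TW) : Prop :=
  base_linear j /\ forall a, j (tV a) = tW (fun k => iota k (a k)).

Variables (TV : vectType K) (TW : vectType L) (j : TV -> TW).

Definition extends_linearly (f : 'End(TV)) (F : 'End(TW)) : Prop :=
  forall x, F (j x) = j (f x).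

Definition real_point (p : {vspace TW}) : Prop :=
  exists2 v, v != 0 & p = <[j v]>%VS.

(* The L-span of [j A]. *)
Definition extend_vspace (A : {vspace TV}) : {vspace TW} :=
  (\sum_(v <- vbasis A) <[j v]>)%VS.

End Scalars.

Section Conjugation.
Variables (F4 : fieldExtType 'F_2) (TV : vectType 'F_2) (TW : vectType F4).

Definition is_conjugation (j : TV -> TW) (c : TW -> TW) : Prop :=
  [/\ forall x y, c (x + y) = c x + c y,
      forall (z : F4) x, c (z *: x) = z ^+ 2 *: c x
    & forall v, c (j v) = j v].

Definition conjugate_subspaces (c : TW -> TW) (A B : {vspace TW}) : Prop :=
  forall y, y \in B <-> exists2 x, x \in A & y = c x.

Definition is_real (c : TW -> TW) (A : {vspace TW}) : Prop :=
  conjugate_subspaces c A A.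

End Conjugation.

Section Segre.
Variables (m : nat) (V : 'I_m -> vectType 'F_2).
Variables (TV : vectType 'F_2) (tV : (forall k, V k) -> TV).

Definition segre (p : {vspace TV}) : Prop :=
  exists2 a : forall k, V k, (forall k, a k != 0) & p = <[tV a]>%VS.

(* Elements of PGL(TV) are represented by bijective linear maps. *)
Definition segre_stabiliser (f : 'End(TV)) : Prop :=
  lker f = 0%VS /\ maps_onto f segre.

(* The action of the stabiliser on P(TW). *)
Definition segre_group (F4 : fieldExtType 'F_2) (TW : vectType F4)
    (j : TV -> TW) (F : 'End(TW)) : Prop :=
  exists2 f, segre_stabiliser f & extends_linearly j f F.

(* The k-th generator through the point <[tV a]>: the image of the map
   [x |-> tV (dfwith a x)], which is linear in [x : V k] (so that [linfun]
   returns this very map) when [tV] is multilinear. *)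
Definition segre_generator (a : forall k, V k) (k : 'I_m) : {vspace TV} :=
  limg (linfun (fun x : V k => tV (dfwith (T := V) a x))).

Definition tangent_space (a : forall k, V k) : {vspace TV} :=
  (\sum_k segre_generator a k)%VS.

Definition tangent_line (a : forall k, V k) (l : {vspace TV}) : Prop :=
  [/\ is_line l, (<[tV a]> <= l)%VS & (l <= tangent_space a)%VS].

Definition distinguished_tangent (l : {vspace TV}) : Prop :=
  exists a : forall k, V k,
    [/\ forall k, a k != 0,
        tangent_line a l
      & forall k, ~~ (l <= \sum_(k' | k' != k) segre_generator a k')%VS].

End Segre.

Section InvariantBasis.
Variables (F4 : fieldExtType 'F_2) (w : F4) (m : nat).
Variables (V : 'I_m -> vectType 'F_2) (W : 'I_m -> vectType F4).
Variables (iota : forall k, V k -> W k) (e0 e1 : forall k, V k).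
Variables (TW : vectType F4) (tW : (forall k, W k) -> TW).

(* Multi-indices in {0,1}^m; [true] stands for 1. *)
Definition mindex := {ffun 'I_m -> bool}.

Definition opposite (i : mindex) : mindex := [ffun k => ~~ i k].

Definition odd_index (i : mindex) : bool := odd #|[set k | i k]|.

Definition u_vec (b : bool) (k : 'I_m) : W k :=
  iota (e0 k) + (if b then w ^+ 2 else w) *: iota (e1 k).

Definition U_vec (i : mindex) : TW := tW (fun k => u_vec (i k) k).

Definition basis_plus : seq {vspace TW} :=
  [seq <[U_vec i]>%VS | i : mindex <- enum {: mindex} & ~~ odd_index i].
Definition basis_minus : seq {vspace TW} :=
  [seq <[U_vec i]>%VS | i : mindex <- enum {: mindex} & odd_index i].

Definition span_plus : {vspace TW} := (\sum_(p <- basis_plus) p)%VS.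
Definition span_minus : {vspace TW} := (\sum_(p <- basis_minus) p)%VS.

Definition opposite_line (i : mindex) : {vspace TW} :=
  (<[U_vec i]> + <[U_vec (opposite i)]>)%VS.

(* [k1] is the position of the first entry of a multi-index. *)
Definition opposite_lines (k1 : 'I_m) : seq {vspace TW} :=
  [seq opposite_line i | i : mindex <- enum {: mindex} & ~~ i k1].

End InvariantBasis.

(* Main.v *)
Require Import Defs.
From HB Require Import structures.
From mathcomp Require Import all_boot all_order all_algebra all_field.
From mathcomp Require Import fingroup perm.
From mathcomp Require Import ring.
From Stdlib Require Import FunctionalExtensionality.


(** Identify each [V_k] with the field of four elements by the F_2-linear map
    sending [a] to the [z] such that 1 (x) [a] = [z] u_0 + [z]^2 u_1 in [W_k].
    In the basis [U_i] a pure tensor with coordinates [z = (z_k)], all nonzero,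
    then has the coefficients [chi i z], the product over [k] of [z_k] or
    [z_k]^2 according to the [k]-th entry of [i]. So the Segre variety is the
    abelian group of all [z], of exponent 3, and the [chi i] are its characters
    with no trivial component.

    Let [F] stabilise the Segre variety. Each row of the matrix of [F] in the
    basis [U_i], evaluated at a pure tensor, gives a coefficient of a pure
    tensor, hence a combination of the characters [chi l] without zeros. Such a
    combination has a single term ([nonvanishing_monomial]), by induction on
    the coordinates: for nonzero [a], [b] in a field of four elements the
    binomial [a + c b] vanishes for some nonzero [c]. Therefore [F] permutes the
    points of the invariant basis. Moreover [F] induces a map on the tuples [z]
    that transforms characters into multiples of characters. Comparing the
    images of 1 and of a tuple with a single entry different from 1 shows that
    the induced permutation of the cube {0,1}^m permutes the coordinates and
    then flips some of them ([matrix_signed_perm], [segre_group_monomial]). Such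
    a permutation preserves the pairs of opposite vertices, and either preserves
    or exchanges the two parity classes.

    The invariance statements follow at once, since all subspaces involved are
    spanned by parts of the invariant basis ([cspan]). Complex conjugation maps
    [U_i] to [U_i'] ([conj_coord]), and [i'] has the parity of [i] or not
    according to the parity of [m]. The real points of the line through [U_i]
    and [U_i'] are generated by the vectors [c U_i + c^2 U_i'] with [c] nonzero
    ([real_point_pair_line]), and the maps [z_k |-> zeta_k z_k] or its square,
    applied in each factor, act transitively on them ([rescale_group]).

    Finally, the distinguished tangent at a pure tensor [p] with coordinates [z]
    joins [p] to the sum of the [m] pure tensors obtained by replacing one [z_k]
    by [w z_k] ([distinguished_tangent_span]). The [U_i]-coefficient of that sum
    is [chi i z] times [m w + |i|], because [w^2 = w + 1]; so over the field of
    four elements the tangent is the join of the even and the odd part of [p]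
    ([extended_distinguished_tangent]). *)

Set Implicit Arguments.
Unset Strict Implicit.
Unset Printing Implicit Defensive.
Import GRing.Theory.
Local Open Scope ring_scope.

(** * The field of four elements *)

Lemma F2_cases (c : 'F_2) : c = 0 \/ c = 1.
Proof.
by case: c => [[|[|c]] //] hc; [left | right]; apply: val_inj.
Qed.

Lemma addF2 (V : lmodType 'F_2) (x : V) : x + x = 0.
Proof.
by rewrite -[x in x + _]scale1r -[x in _ + x]scale1r -scalerDl (_ : 1 + 1 = 0)
   ?scale0r //; apply: val_inj.
Qed.

Section FourElements.
Variables (F4 : fieldExtType 'F_2) (w : F4).
Hypotheses (hF4 : \dim {: F4} = 2%N) (hw : w ^+ 2 + w + 1 = 0).
Implicit Types (z r : F4) (b : bool).

Lemma addF4 z : z + z = 0.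
Proof. exact: addF2. Qed.

Lemma addF4_eq0 z r : (z + r == 0) = (z == r).
Proof.
rewrite addr_eq0; suff -> : - r = r by [].
by apply/eqP; rewrite eq_sym -addr_eq0 addF4.
Qed.

Lemma sqrD_F4 z r : (z + r) ^+ 2 = z ^+ 2 + r ^+ 2.
Proof. by rewrite sqrrD mulr2n addF4 addr0. Qed.

Lemma omega_sqr : w ^+ 2 = w + 1.
Proof. by apply/eqP; rewrite -addF4_eq0 addrA hw. Qed.

Lemma omega_neq0 : w != 0.
Proof.
apply/negP => /eqP w0; move: hw; rewrite w0 expr0n /= !add0r => /eqP.
by rewrite oner_eq0.
Qed.

Lemma omega_neq1 : w != 1.
Proof.
by apply/negP=> /eqP w1; move/eqP: omega_sqr; rewrite w1 expr1n addF4 oner_eq0.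
Qed.

Lemma omega_sqr_neq1 : w ^+ 2 != 1.
Proof. by rewrite omega_sqr -addF4_eq0 -addrA addF4 addr0 omega_neq0. Qed.

Lemma omega_neq_sqr : (w == w ^+ 2) = false.
Proof. by rewrite omega_sqr -addF4_eq0 addrA addF4 add0r oner_eq0. Qed.

(** [1] and [w] are independent over F_2, so a two-dimensional extension
    consists of the four combinations of them. *)
Lemma F4_cases z : [\/ z = 0, z = 1, z = w | z = w ^+ 2].
Proof.
have fr : free [:: 1; w].
  rewrite free_cons seq1_free omega_neq0 span_seq1 andbT; apply/vlineP => -[c].
  have [->|->] := F2_cases c; first by move/eqP; rewrite scale0r oner_eq0.
  by rewrite scale1r => /eqP; rewrite eq_sym (negPf omega_neq1).
have bas : basis_of {: F4} [tuple 1; w].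
  by rewrite basisEfree fr subvf hF4.
rewrite (coord_basis bas (memvf z)) !big_ord_recr big_ord0 /= add0r.
move: (coord _ _ z) (coord _ _ z) => a b.
have [->|->] := F2_cases a; have [->|->] := F2_cases b;
  rewrite ?scale0r ?scale1r ?addr0 ?add0r.
- by apply: Or41.
- by apply: Or42.
- by apply: Or43.
by rewrite addrC -omega_sqr; apply: Or44.
Qed.

Lemma omega3 : w ^+ 2 * w = 1.
Proof.
by rewrite omega_sqr mulrDl -expr2 omega_sqr mul1r addrAC addF4 add0r.
Qed.

Lemma expF4_4 z : (z ^+ 2) ^+ 2 = z.
Proof.
have w4 : (w ^+ 2) ^+ 2 = w.
  by rewrite omega_sqr sqrD_F4 expr1n omega_sqr -addrA addF4 addr0.
have [->|->|->|->] := F4_cases z; by rewrite ?w4 ?expr0n ?expr1n.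
Qed.

(** Since squaring is the nontrivial automorphism of the field, [twist b] is
    its [b]-th power; it selects the coefficient of u_b in 1 (x) [a], which is
    the coordinate of [a] or its conjugate. *)
Definition twist b z := if b then z ^+ 2 else z.

Lemma twistM b z r : twist b (z * r) = twist b z * twist b r.
Proof. by case: b; rewrite //= exprMn. Qed.

Lemma twist1 b : twist b 1 = 1.
Proof. by case: b; rewrite //= expr1n. Qed.

Lemma twist_eq0 b z : (twist b z == 0) = (z == 0).
Proof. by case: b; rewrite //= expf_eq0. Qed.

Lemma twist_twist b b' z : twist b (twist b' z) = twist (b' (+) b) z.
Proof. by case: b b' => -[]; rewrite //= expF4_4. Qed.

Lemma twist_neg b z : twist (~~ b) z = twist b z ^+ 2.
Proof. by case: b; rewrite //= expF4_4. Qed.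

Lemma twistD b z r : twist b (z + r) = twist b z + twist b r.
Proof. by case: b; rewrite //= sqrD_F4. Qed.

Lemma twist_omega_inj b b' : twist b w = twist b' w -> b = b'.
Proof.
by case: b b' => -[] //= /eqP; rewrite ?omega_neq_sqr // eq_sym omega_neq_sqr.
Qed.

(** The two primitive cube roots of unity differ by 1; this turns a sum of
    twisted [w] into a count of the entries 1 of a multi-index. *)
Lemma twist_omega b : twist b w = w + b%:R.
Proof. by case: b; rewrite /= ?omega_sqr ?addr0. Qed.

Lemma twist_of_neq1 z : z != 0 -> z != 1 -> exists b, z = twist b w.
Proof.
have [->|->|->|->] := F4_cases z; rewrite ?eqxx // => _ _.
  by exists false.
by exists true.
Qed.

Lemma twist_onto_omega z b : z != 0 -> z != 1 -> exists b', twist b' z = twist b w.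
Proof.
move=> z0 z1; have [b' ->] := twist_of_neq1 z0 z1.
by exists (b (+) b'); rewrite twist_twist addbCA addbb addbF.
Qed.

End FourElements.

(** * Nonvanishing combinations of characters and symmetries of the cube *)

Section Characters.
Variables (F4 : fieldExtType 'F_2) (w : F4).
Hypotheses (hF4 : \dim {: F4} = 2%N) (hw : w ^+ 2 + w + 1 = 0).
Variable m : nat.
Implicit Types (i : mindex m) (z r : 'I_m -> F4) (k : 'I_m).

Definition nonvanishing z := forall k, z k != 0.

(** The coefficient at [U_i] of the pure tensor with coordinates [z]; for
    nonvanishing [z] it is a character of the group of all such [z]. *)
Definition chi i z : F4 := \prod_k twist (i k) (z k).

Definition point_at k (c : F4) : 'I_m -> F4 := fun l => if l == k then c else 1.

Definition flip k i : mindex m := [ffun l => i l (+) (l == k)].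

Lemma flipK k : involutive (flip k).
Proof. by move=> i; apply/ffunP=> l; rewrite !ffunE -addbA addbb addbF. Qed.

Lemma chi1 i : chi i (fun=> 1) = 1.
Proof. by apply: big1 => k _; rewrite twist1. Qed.

Lemma chiM i z r : chi i (fun k => z k * r k) = chi i z * chi i r.
Proof. by rewrite -big_split; apply: eq_bigr => k _; rewrite /= twistM. Qed.

Lemma chi_neq0 i z : nonvanishing z -> chi i z != 0.
Proof. by move=> z0; apply/prodf_neq0 => k _; rewrite twist_eq0 z0. Qed.

Lemma chi_opposite i z : chi (opposite i) z = chi i z ^+ 2.
Proof.
by rewrite -prodrXl; apply: eq_bigr => k _; rewrite ffunE (twist_neg hF4 hw).
Qed.

Lemma chi_point i k c : chi i (point_at k c) = twist (i k) c.
Proof.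
rewrite /chi (bigD1 k) //= big1 => [|l lk]; first by rewrite mulr1 /point_at eqxx.
by rewrite /point_at (negPf lk) twist1.
Qed.

Lemma point_at_neq0 k c : c != 0 -> nonvanishing (point_at k c).
Proof. by move=> c0 l; rewrite /point_at; case: ifP; rewrite // oner_eq0. Qed.

Let nonvanishing_on (M : mindex m -> F4) :=
  forall z, nonvanishing z -> \sum_i M i * chi i z != 0.

(** Fixing the coordinate [k] of a combination of characters at the value [c]
    leaves a combination of the characters in the remaining coordinates, whose
    coefficients are indexed here by the [i] with [i k] false. The factors [c]
    and [z k] account for the entry [k] of [z], which [chi] retains; so the
    induction below can stay on the whole cube. *)
Lemma restrict_coordinate (M : mindex m -> F4) k c z :
  (\sum_(i : mindex m) (if i k then 0 else M i + c * M (flip k i)) * chi i z) * c =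
  z k * \sum_i M i * chi i (fun l => if l == k then c else z l).
Proof.
pose R i := \prod_(l | l != k) twist (i l) (z l).
have chiR i : chi i z = twist (i k) (z k) * R i by rewrite /chi (bigD1 k).
have chiR' i : chi i (fun l => if l == k then c else z l) = twist (i k) c * R i.
  rewrite /chi (bigD1 k) //= eqxx; congr (_ * _).
  by apply: eq_bigr => l /negPf ->.
have Rflip i : R (flip k i) = R i.
  by apply: eq_bigr => l /negPf lk; rewrite ffunE lk addbF.
rewrite [in RHS](bigID (fun i : mindex m => i k)) /=.
rewrite [X in X + _](reindex_inj (can_inj (flipK k))) /=.
rewrite [X in X + _](eq_bigl (fun i : mindex m => ~~ i k)); last first.
  by move=> i; rewrite ffunE eqxx addbT.
rewrite -big_split /= (bigID (fun i : mindex m => i k)) /= big1 ?add0r; last first.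
  by move=> i ->; rewrite mul0r.
rewrite mulr_suml mulr_sumr; apply: eq_bigr => i /negPf ik.
by rewrite chiR !chiR' Rflip ffunE ik eqxx /=; ring.
Qed.

(** If both [a] and [b] are nonzero then [c := a / b] is a nonzero root of [a
    + c b], the characteristic being 2. *)
Lemma pencil_exactly_one (a b : F4) :
  (forall c, c != 0 -> a + c * b != 0) -> (a == 0) = (b != 0).
Proof.
move=> h; have := h 1 (oner_neq0 _); rewrite mul1r.
have [->|b0] := eqVneq b 0; first by rewrite addr0 => /negPf.
move=> _ /=; have [//|a0] := eqVneq a 0.
have := h (a / b) (mulf_neq0 a0 (invr_neq0 b0)).
by rewrite divfK // addF4 eqxx.
Qed.

Lemma pencil_two_zeros (a b c c' : F4) :
  c != c' -> a + c * b == 0 -> a + c' * b == 0 -> (a == 0) && (b == 0).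
Proof.
rewrite !addF4_eq0 => cc /eqP -> /eqP/eqP.
rewrite -subr_eq0 -mulrBl mulf_eq0 subr_eq0 (negPf cc) /= => /eqP ->.
by rewrite mulr0 eqxx.
Qed.

(** The induction removes one coordinate [k] at a time from the set of
    coordinates in which the indices of nonzero coefficients may differ.
    Fixing the coordinate [k] at [c = 1, w, w^2] gives three combinations,
    each of which has a single term by induction. A pair of coefficients at
    [i] and [flip k i] that is not (0, 0) shows up in at least two of the
    three, so there is just one such pair, and [pencil_exactly_one] leaves one
    nonzero coefficient in it. *)
Lemma nonvanishing_monomial (M : mindex m -> F4) :
  nonvanishing_on M -> exists i0, forall i, (M i != 0) = (i == i0).
Proof.
pose agree_off (r : seq 'I_m) (N : mindex m -> F4) :=
  forall i l, N i != 0 -> N l != 0 -> forall k, k \notin r -> i k = l k.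
suff gen (r : seq 'I_m) N : nonvanishing_on N -> agree_off r N ->
    exists i0, forall i, (N i != 0) = (i == i0).
  by move=> hM; apply: (gen (enum 'I_m)) => // i l _ _ k; rewrite mem_enum.
elim: r N => [|k r IHr] N hN off.
  have [i0 Ni0|N0] := pickP (fun i => N i != 0).
    exists i0 => i; apply/idP/eqP => [Ni | -> //].
    by apply/ffunP => k; apply: off.
  have /eqP[] := hN (fun=> 1) (fun=> oner_neq0 _).
  by rewrite big1 // => i _; move/negbFE/eqP: (N0 i) => ->; rewrite mul0r.
pose Nc c i := if i k then 0 else N i + c * N (flip k i).
have Nc_pair c i : Nc c i != 0 -> ~~ i k /\ ((N i != 0) || (N (flip k i) != 0)).
  rewrite /Nc; case: ifP => [|_]; first by rewrite eqxx.
  move=> h; split=> //; apply: contraR h.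
  by rewrite negb_or !negbK => /andP[/eqP-> /eqP->]; rewrite mulr0 addr0.
have IHc c : c != 0 -> exists i0, forall i, (Nc c i != 0) = (i == i0).
  move=> c0; apply: IHr => [z hz|i l /Nc_pair[ik Ni] /Nc_pair[lk Nl] k' k'r].
    have : z k * \sum_i N i * chi i (fun l => if l == k then c else z l) != 0.
      by rewrite mulf_neq0 ?hz // hN // => l; case: ifP.
    by rewrite -restrict_coordinate mulf_eq0 negb_or => /andP[].
  have [->|kk'] := eqVneq k' k; first by rewrite (negPf ik) (negPf lk).
  have flk j : flip k j k' = j k' by rewrite ffunE (negPf kk') addbF.
  have k'kr : k' \notin k :: r by rewrite inE negb_or kk'.
  case/orP: Ni => Ni; case/orP: Nl => Nl; have := off _ _ Ni Nl _ k'kr;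
  by rewrite ?flk.
have [i1 h1] := IHc 1 (oner_neq0 _).
have [i2 h2] := IHc w (omega_neq0 hw).
have [i3 h3] := IHc (w ^+ 2) (expf_neq0 _ (omega_neq0 hw)).
(* The pairs of coefficients at the vertices [i] and [flip k i] that are not
   both zero, represented by the vertex with [i k] false. *)
pose pair i := ~~ i k && ((N i != 0) || (N (flip k i) != 0)).
have two i : pair i ->
    [|| (i == i1) && (i == i2), (i == i1) && (i == i3) | (i == i2) && (i == i3)].
  case/andP=> ik; apply: contraTT; rewrite -h1 -h2 -h3 /Nc (negPf ik).
  have ww : w != w ^+ 2 by rewrite (omega_neq_sqr hw).
  have w1 := omega_neq1 hw; have w21 := omega_sqr_neq1 hw.
  rewrite !negb_or; set a := N i; set b := N _.
  move=> h; have: (a == 0) && (b == 0); last by case/andP=> -> ->.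
  move: h; case E1: (a + 1 * b == 0); case E2: (a + w * b == 0);
    case E3: (a + w ^+ 2 * b == 0) => //= _;
    first [ by apply: pencil_two_zeros E1 E2; rewrite eq_sym
          | by apply: pencil_two_zeros E1 E3; rewrite eq_sym
          | by apply: pencil_two_zeros E2 E3 ].
have pair_of c i : Nc c i != 0 -> pair i.
  by move/Nc_pair=> [ik ?]; rewrite /pair ik.
have p1 : pair i1 by apply: (pair_of 1); rewrite h1.
have p2 : pair i2 by apply: (pair_of w); rewrite h2.
have p3 : pair i3 by apply: (pair_of (w ^+ 2)); rewrite h3.
(* Two different pairs would need four of the three single-term supports. *)
have uni i : pair i -> i = i1.
  move=> pi; case/or3P: (two _ pi) => /andP[/eqP e1 /eqP e2] //.
  by case/or3P: (two _ p1) => /andP[/eqP e3 /eqP e4]; congruence.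
have ex := pencil_exactly_one (a := N i1) (b := N (flip k i1)).
have {}ex : (N i1 == 0) = (N (flip k i1) != 0).
  have i1k : i1 k = false by case/andP: p1 => /negPf.
  have Nce c : Nc c i1 = N i1 + c * N (flip k i1) by rewrite /Nc i1k.
  apply: ex => c c0; rewrite -Nce.
  have [c00|->|->|->] := F4_cases hF4 hw c; first by rewrite c00 eqxx in c0.
  - by rewrite h1.
  - by rewrite h2 (uni _ p2).
  - by rewrite h3 (uni _ p3).
exists (if N i1 == 0 then flip k i1 else i1) => i.
have Ni : N i != 0 -> i = i1 \/ i = flip k i1.
  move=> Ni; case ik: (i k).
    right; rewrite -(uni (flip k i)) ?flipK // /pair ffunE eqxx ik /=.
    by rewrite flipK Ni orbT.
  by left; apply: uni; rewrite /pair ik Ni.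
apply/idP/eqP => [h|->].
  case: (Ni h) => e; first by rewrite -e (negPf h).
  by rewrite ex -e h.
by case: ifP => [|/negbT //]; rewrite ex.
Qed.

(** If two entries of [r] differed from 1, then [i] could be chosen so that
    their contributions to [chi i r] are any two prescribed primitive cube
    roots of unity. Every cube root of unity is a product of two primitive
    ones, so [chi i r] would be 1 for some [i]. *)
Lemma chi_neq1_single r : nonvanishing r -> (forall i, chi i r != 1) ->
  exists ls : 'I_m * bool, forall i, chi i r = twist (i ls.1 (+) ls.2) w.
Proof.
move=> r0 hr.
have [l rl|all1] := pickP (fun l => r l != 1); last first.
  have /eqP[] := hr [ffun=> false]; apply: big1 => k _.
  by rewrite ffunE /=; apply/eqP/negbFE/all1.
have others k : k != l -> r k = 1.
  move=> kl; apply/eqP/negPn/negP => rk.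
  (* The contribution of the other entries, for [i] vanishing there; the
     entries of [i] at [l] and [k] are then chosen to cancel it. *)
  pose P := \prod_(j | (j != l) && (j != k)) r j.
  have chiE b b' : chi [ffun j => if j == l then b else if j == k then b' else false] r
      = twist b (r l) * (twist b' (r k) * P).
    rewrite /chi (bigD1 l) // (bigD1 k) //= !ffunE eqxx (negPf kl) eqxx.
    congr (_ * (_ * _)); apply: eq_bigr => j /andP[/negPf jl /negPf jk].
    by rewrite ffunE jl jk.
  have P0 : P != 0 by apply/prodf_neq0 => j _.
  have [s [s' ss]] : exists s s', twist s w * (twist s' w * P) = 1.
    have [c|->|->|->] := F4_cases hF4 hw P; first by rewrite c eqxx in P0.
    - by exists true, false; rewrite mulr1 /= (omega3 hw).
    - by exists false, false; rewrite /= mulrC -expr2 (omega3 hw).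
    - exists true, true; rewrite /= mulrA -!expr2 (expF4_4 hF4 hw).
      by rewrite mulrC (omega3 hw).
  have [b eb] := twist_onto_omega hF4 hw s (r0 l) rl.
  have [b' eb'] := twist_onto_omega hF4 hw s' (r0 k) rk.
  by have /eqP[] := hr [ffun j => if j == l then b else if j == k then b' else false];
    rewrite chiE eb eb'.
have [s es] := twist_of_neq1 hF4 hw (r0 l) rl.
exists (l, s) => i; rewrite /chi (bigD1 l) //= big1 => [|k kl].
  by rewrite mulr1 es (twist_twist hF4 hw) addbC.
by rewrite (others k kl) twist1.
Qed.

(** The symmetries of the cube {0,1}^m: permutations of the coordinates
    followed by flips; they act on the vectors with entries 1 and -1 as signed
    permutation matrices. *)
Definition signed_perm (tau : {perm 'I_m}) (s i : mindex m) : mindex m :=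
  [ffun k => i (tau k) (+) s k].

Lemma signed_perm_inj tau s : injective (signed_perm tau s).
Proof.
move=> i l /ffunP e; apply/ffunP => k; move: (e ((tau^-1)%g k)).
by rewrite !ffunE permKV => /addIb.
Qed.

Lemma signed_perm_opposite tau s i :
  signed_perm tau s (opposite i) = opposite (signed_perm tau s i).
Proof. by apply/ffunP => k; rewrite !ffunE addNb. Qed.

Lemma odd_index_sum i : odd_index i = \big[addb/false]_k i k.
Proof.
rewrite /odd_index -sum1dep_card (big_morph odd oddD (erefl : odd 0 = false)).
by rewrite big_mkcond; apply: eq_bigr => k _; case: (i k).
Qed.

Lemma odd_index_signed_perm tau s i :
  odd_index (signed_perm tau s i) = odd_index i (+) odd_index s.
Proof.
rewrite !odd_index_sum [X in X (+) _](reindex_inj (@perm_inj _ tau)) -big_split.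
by apply: eq_bigr => k _; rewrite ffunE.
Qed.

Lemma odd_index_opposite i : odd_index (opposite i) = odd_index i (+) odd m.
Proof.
rewrite !odd_index_sum; have -> : odd m = \big[addb/false]_(k < m) true.
  by rewrite -[in LHS](card_ord m) -sum1_card (big_morph odd oddD (erefl : odd 0 = false)).
by rewrite -big_split; apply: eq_bigr => k _; rewrite ffunE /= addbT.
Qed.

(** The hypotheses say that [M] maps the set of the vectors with entries [chi
    i z], for nonvanishing [z], onto itself. Each row of [M] is a nonvanishing
    combination of characters, hence has a single entry, in a column [pi i].
    For a tuple with the single entry [w] at [k], the quotient [r] of its
    image by the image of 1 satisfies [chi i r = twist (pi i k) w], and this
    never being 1 makes [pi i k] depend on a single entry of [i]. *)
Lemma matrix_signed_perm (M : mindex m -> mindex m -> F4) :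
    (forall z, nonvanishing z -> exists2 z', nonvanishing z' &
       forall i, \sum_l M i l * chi l z = chi i z') ->
    (forall z', nonvanishing z' -> exists2 z, nonvanishing z &
       forall i, \sum_l M i l * chi l z = chi i z') ->
  exists tau s c, (forall i, c i != 0) /\
    forall i l, M i l = if l == signed_perm tau s i then c i else 0.
Proof.
move=> Mto Monto.
have /fin_all_exists[pi hpi] i : exists i0, forall l, (M i l != 0) = (l == i0).
  apply: nonvanishing_monomial => z /Mto[z' z'0 ->]; exact: chi_neq0.
pose c i := M i (pi i).
have c0 i : c i != 0 by rewrite hpi.
have ME i l : M i l = if l == pi i then c i else 0.
  by case: eqP => [-> //|/eqP]; rewrite -hpi => /negPn/eqP.
have sumE i z : \sum_l M i l * chi l z = c i * chi (pi i) z.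
  rewrite (bigD1 (pi i)) //= big1 ?addr0 // => l /negPf lpi.
  by rewrite ME lpi mul0r.
have pi_inj : injective pi.
  move=> i l il; have cc z : nonvanishing z -> c l * chi i z = c i * chi l z.
    by move=> /Monto[z' _ h]; rewrite -!h !sumE il; ring.
  have := cc (fun=> 1) (fun=> oner_neq0 _); rewrite !chi1 !mulr1 => ecl.
  apply/ffunP => k; have := cc _ (point_at_neq0 k (omega_neq0 hw)).
  by rewrite ecl !chi_point => /(mulfI (c0 i)) /(twist_omega_inj hw).
have [z1 z10 hz1] := Mto (fun=> 1) (fun=> oner_neq0 _).
have /fin_all_exists[ts hts] k :
    exists ls : 'I_m * bool, forall i, pi i k = i ls.1 (+) ls.2.
  have [zk zk0 hzk] := Mto _ (point_at_neq0 k (omega_neq0 hw)).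
  pose r l := zk l / z1 l.
  have r0 : nonvanishing r by move=> l; rewrite mulf_neq0 ?invr_neq0.
  have chir i : chi i r = twist (pi i k) w.
    have : chi i r * chi i z1 = chi i zk.
      by rewrite -chiM; apply: eq_bigr => l _; rewrite /r divfK.
    rewrite -hz1 -hzk !sumE chi1 chi_point mulr1 mulrC; exact: mulfI.
  have [i|ls hls] := chi_neq1_single r0.
    by rewrite chir; case: (pi i k); rewrite ?(omega_neq1 hw) ?(omega_sqr_neq1 hw).
  by exists ls => i; apply: (twist_omega_inj hw); rewrite -chir hls.
pose tau0 k := (ts k).1.
(* If no entry of [pi i] depended on the entry [l] of [i], then flipping the
   latter would contradict the injectivity of [pi]. *)
have /fin_all_exists[g gK] l : exists k, tau0 k = l.
  have [k /eqP kl|none] := pickP (fun k => tau0 k == l); first by exists k.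
  have : flip l [ffun=> false] = [ffun=> false] :> mindex m.
    apply: pi_inj; apply/ffunP => k.
    by rewrite !hts [flip _ _ _]ffunE -/(tau0 k) none addbF.
  by move/ffunP/(_ l); rewrite !ffunE eqxx.
have tau_inj : injective tau0 by apply: can_inj (canF_sym gK).
exists (perm tau_inj), [ffun k => (ts k).2], c; split=> // i l.
rewrite ME; congr (if _ == _ then _ else _).
by apply/ffunP => k; rewrite hts !ffunE permE.
Qed.

End Characters.

(** * Dual bases of tensor products and of scalar extensions *)

(** The generators of the Segre variety are images under [linfun] of plain
    functions, to which [lfunE] does not apply. *)
Lemma linear_linfunE (K : fieldType) (U V : vectType K) (f : U -> V) :
  linear f -> linfun f =1 f.
Proof.
move=> linf x.
pose fl : {linear U -> V} := HB.pack f (GRing.isLinear.Build K U V _ f linf).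
exact: (lfunE fl).
Qed.

(** A basis given together with its coordinate forms. Unlike [basis_of], it
    allows any finite index type, which makes it stable under tensor products.
    *)
Definition dual_frame (K : fieldType) (I : finType) (T : vectType K) (u : I -> T)
    (g : I -> 'Hom(T, K^o)) : Prop :=
  (forall i l, g i (u l) = (i == l)%:R) /\ (forall y, y = \sum_i g i y *: u i).

Lemma expansion_lfun (K : fieldType) (I : finType) (T : vectType K)
    (u : I -> T) (g : I -> 'Hom(T, K^o)) :
  exists H : 'End(T), forall y, H y = \sum_i g i y *: u i.
Proof.
exists (linfun (fun y => \sum_i g i y *: u i)) => y.
apply: (linear_linfunE (f := fun y => \sum_i g i y *: u i)) => b x z.
rewrite scaler_sumr -big_split.
by apply: eq_bigr => i _; rewrite linearP /= scalerDl scalerA.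
Qed.

Lemma basis_frame (K : fieldType) (V : vectType K) (e0 e1 : V) :
    basis_of {: V} [:: e0; e1] ->
  exists c : bool -> 'Hom(V, K^o), dual_frame (fun b : bool => if b then e1 else e0) c.
Proof.
move=> bas; have {}bas : basis_of {: V} [tuple e0; e1] by [].
pose o (b : bool) : 'I_2 := if b then ord_max else ord0.
pose c b : V -> K^o := coord [tuple e0; e1] (o b).
have lin_c b : linear (c b) by move=> a x y; rewrite /c linearP.
exists (fun b => linfun (c b)); split=> [b b'|y].
  have nthE : (if b' then e1 else e0) = [tuple e0; e1]`_(o b') by case: b'.
  by rewrite linear_linfunE // /c nthE coord_free ?(basis_free bas) //; case: b b' {nthE} => -[].
rewrite [LHS](coord_basis bas (memvf y)) big_bool !linear_linfunE //.
rewrite !big_ord_recr big_ord0 /= add0r addrC.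
by congr (coord _ _ _ *: _ + coord _ _ _ *: _); apply: val_inj.
Qed.

Section Frames.
Variables (K : fieldType) (I : finType).

Variables (m : nat) (V : 'I_m -> vectType K).

Lemma dfwith_id (a : forall k, V k) k : dfwith (T := V) a (a k) = a.
Proof. by apply: functional_extensionality_dep => l; case: dfwithP. Qed.

Lemma multilinear_slot (U : vectType K) (f : (forall k, V k) -> U) a k :
  multilinear f -> exists g : 'Hom(V k, U), forall x, g x = f (dfwith (T := V) a x).
Proof.
move=> mf; exists (linfun (fun x => f (dfwith (T := V) a x))) => x.
by rewrite linear_linfunE // => c y z; apply: mf.
Qed.

(** Replacing one argument after the other by basis vectors expresses the
    values of a multilinear map by its values at families of basis vectors. *)
Lemma multilinear_eq (U : vectType K) (f h : (forall k, V k) -> U)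
    (u : forall k, I -> V k) (c : forall k, I -> 'Hom(V k, K^o)) :
    (forall k, dual_frame (u k) (c k)) -> multilinear f -> multilinear h ->
    (forall i : {ffun 'I_m -> I}, f (fun k => u k (i k)) = h (fun k => u k (i k))) ->
  forall a, f a = h a.
Proof.
move=> frame mf mh eqfh.
suff gen (r : seq 'I_m) : forall a : forall k, V k,
    (forall k, k \notin r -> exists i, a k = u k i) -> f a = h a.
  by move=> a; apply: (gen (enum 'I_m)) => k; rewrite mem_enum.
elim: r => [|k r IHr] a ha.
  have /fin_all_exists[i hi] k : exists i, a k = u k i by apply: ha.
  have -> : a = fun k => u k ([ffun k => i k] k).
    by apply: functional_extensionality_dep => k; rewrite ffunE.
  exact: eqfh.
have [f1 f1E] := multilinear_slot a k mf; have [h1 h1E] := multilinear_slot a k mh.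
rewrite -(dfwith_id a k) -f1E -h1E [a k](proj2 (frame k)) !linear_sum.
apply: eq_bigr => i _; rewrite !linearZ /= f1E h1E; congr (_ *: _).
apply: IHr => l; case: dfwithP => [_|l' kl' l'r]; first by exists i.
by apply: ha; rewrite inE negb_or eq_sym kl' l'r.
Qed.

Lemma multilinear_comp (U U' : vectType K) (f : (forall k, V k) -> U)
    (g : 'Hom(U, U')) : multilinear f -> multilinear (fun a => g (f a)).
Proof. by move=> mf a k c x y; rewrite mf linearP. Qed.

Lemma multilinear_prod (c : forall k, 'Hom(V k, K^o)) :
  multilinear (U := K^o) (fun a => \prod_k c k (a k)).
Proof.
move=> a k b x y.
have E z : \prod_l c l (dfwith (T := V) a z l) =
    c k z * \prod_(l | l != k) c l (a l).
  rewrite (bigD1 k) //= dfwith_in; congr (_ * _); apply: eq_bigr => l lk.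
  by rewrite dfwith_out // eq_sym.
by rewrite !E linearP mulrDl /= -!mulrA.
Qed.

Variables (T : vectType K) (t : (forall k, V k) -> T).
Hypothesis tensor_t : is_tensor_product t.

(** The uniqueness half of the universal property, applied to the restriction
    of [g] to pure tensors. *)
Lemma tensor_lfun_eq (U : vectType K) (g h : 'Hom(T, U)) :
  (forall a, g (t a) = h (t a)) -> g = h.
Proof.
have [mt univ] := tensor_t => gh.
have [f [_ uniq_f]] := univ U _ (multilinear_comp g mt).
by rewrite -(uniq_f g) // -(uniq_f h).
Qed.

(** The products of coordinate forms extend to linear forms by the universal
    property. That the pure tensors of basis vectors generate the space
    follows from uniqueness: the projection onto their span defined by these
    forms agrees with the identity on pure tensors. *)
Lemma tensor_frame (u : forall k, I -> V k) (c : forall k, I -> 'Hom(V k, K^o)) :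
    (forall k, dual_frame (u k) (c k)) ->
  exists2 g : {ffun 'I_m -> I} -> 'Hom(T, K^o),
    dual_frame (fun i : {ffun 'I_m -> I} => t (fun k => u k (i k))) g &
    forall i a, g i (t a) = \prod_k c k (i k) (a k).
Proof.
move=> frame; have [mt univ] := tensor_t.
have /fin_all_exists[g hg] (i : {ffun 'I_m -> I}) :
    exists gi : 'Hom(T, K^o), forall a, gi (t a) = \prod_k c k (i k) (a k).
  have [gi [hgi _]] := univ K^o _ (multilinear_prod (fun k => c k (i k))).
  by exists gi.
have gu (i l : {ffun 'I_m -> I}) : g i (t (fun k => u k (l k))) = (i == l)%:R.
  rewrite hg; have [->|/eqP il] := eqVneq i l.
    by apply: big1 => k _; rewrite (proj1 (frame k)) eqxx.
  have [k /negPf ilk] : exists k, i k != l k.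
    by apply/existsP; apply: contraT; rewrite negb_exists => /forallP h;
      case: il; apply/ffunP => k; apply/eqP/negPn/h.
  by rewrite (bigD1 k) //= (proj1 (frame k)) ilk mul0r.
exists g => //; split=> // y.
have [H HE] := expansion_lfun (fun i : {ffun 'I_m -> I} => t (fun k => u k (i k))) g.
suff : \1%VF = H by move=> e; rewrite -HE -e lfunE.
apply: tensor_lfun_eq => a; rewrite lfunE /=; move: a.
apply: (multilinear_eq frame mt (multilinear_comp H mt)) => i.
rewrite HE (bigD1 i) //= big1 => [|l /negPf li].
  by rewrite gu eqxx scale1r addr0.
by rewrite gu li scale0r.
Qed.

End Frames.

Section BaseLinear.
Variables (K : fieldType) (L : fieldExtType K) (V : vectType K) (U : vectType L).
Variable f : V -> U.
Hypothesis lin_f : base_linear f.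

Lemma base_linearD x y : f (x + y) = f x + f y.
Proof. by have := lin_f 1 x y; rewrite !scale1r. Qed.

Lemma base_linear0 : f 0 = 0.
Proof. by apply: (addrI (f 0)); rewrite -base_linearD !addr0. Qed.

Lemma base_linearZ (c : K) x : f (c *: x) = c%:A *: f x.
Proof. by rewrite -[c *: x]addr0 lin_f base_linear0 addr0. Qed.

Lemma base_linear_sum (I : finType) (F : I -> V) :
  f (\sum_i F i) = \sum_i f (F i).
Proof. exact: (big_morph f base_linearD base_linear0). Qed.

Lemma base_linear_comp (U' : vectType L) (g : 'Hom(U, U')) :
  base_linear (fun v => g (f v)).
Proof. by move=> c x y; rewrite lin_f linearP. Qed.

End BaseLinear.

Section ScalarExtension.
Variables (K : fieldType) (L : fieldExtType K) (V : vectType K) (W : vectType L).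
Variable iota : V -> W.
Hypothesis ext_iota : is_scalar_extension iota.

Lemma scalar_extension_lfun_eq (U : vectType L) (g h : 'Hom(W, U)) :
  (forall v, g (iota v) = h (iota v)) -> g = h.
Proof.
have [lin_iota univ] := ext_iota => gh.
have [f [_ uniq_f]] := univ U _ (base_linear_comp lin_iota g).
by rewrite -(uniq_f g) // -(uniq_f h).
Qed.

(** The analogue of [tensor_frame] for scalar extensions: the forms [phi b]
    extend by the universal property, and the expansion of [iota v] extends to
    the whole space by uniqueness. *)
Lemma scalar_extension_frame (I : finType) (u : I -> W) (phi : I -> V -> L) :
    (forall b, base_linear (U := L^o) (phi b)) ->
    (forall v, iota v = \sum_b phi b v *: u b) ->
    (forall g : I -> 'Hom(W, L^o), (forall b v, g b (iota v) = phi b v) ->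
       forall b b', g b (u b') = (b == b')%:R) ->
  exists2 g : I -> 'Hom(W, L^o), dual_frame u g &
    forall b v, g b (iota v) = phi b v.
Proof.
move=> lin_phi iotaE dual_g; have [_ univ] := ext_iota.
have /fin_all_exists[g hg] b : exists gb : 'Hom(W, L^o), forall v, gb (iota v) = phi b v.
  by have [gb [hgb _]] := univ L^o _ (lin_phi b); exists gb.
exists g => //; split=> [|y]; first exact: dual_g.
have [H HE] := expansion_lfun u g.
suff : \1%VF = H by move=> e; rewrite -HE -e lfunE.
apply: scalar_extension_lfun_eq => v; rewrite lfunE /= HE iotaE.
by apply: eq_bigr => b _; rewrite -iotaE hg.
Qed.

End ScalarExtension.

(** * Projective subspaces spanned by parts of a basis *)

Section ProjectiveLemmas.
Variables (K : fieldType) (T : vectType K).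
Implicit Types (A B : {vspace T}) (F : 'End(T)).

Lemma pointP (p : {vspace T}) : is_point p <-> exists2 v, v != 0 & p = <[v]>%VS.
Proof.
split=> [dp | [v v0 ->]]; last by rewrite /is_point dim_vline v0.
have p0 : p != 0%VS by rewrite -dimv_eq0 dp.
exists (vpick p); first by rewrite vpick0.
by apply/eqP; rewrite eq_sym eqEdim -memvE memv_pick dim_vline vpick0 p0 dp.
Qed.

Lemma eq_line_scale (x y : T) : y != 0 -> <[x]>%VS = <[y]>%VS ->
  exists2 c, c != 0 & y = c *: x.
Proof.
move=> y0 exy; have /vlineP[c yE] : y \in <[x]>%VS by rewrite exy memv_line.
by exists c => //; apply: contraNneq y0 => c0; rewrite yE c0 scale0r.
Qed.

Lemma scale_line (c : K) (x : T) : c != 0 -> <[c *: x]>%VS = <[x]>%VS.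
Proof.
move=> c0; apply/vspaceP => y; apply/vlineP/vlineP => -[b ->].
  by exists (b * c); rewrite scalerA.
by exists (b / c); rewrite scalerA divfK.
Qed.

Lemma line_span A p q :
    is_line A -> p != 0 -> p \in A -> q \in A -> q \notin <[p]>%VS ->
  A = (<[p]> + <[q]>)%VS.
Proof.
move=> dA p0 pA qA qp; apply/eqP; rewrite eq_sym eqEdim subv_add -!memvE pA qA dA /=.
have := ltn_leqif (dimv_leqif_eq (addvSl <[p]> <[q]>)); rewrite dim_vline p0 => ->.
apply: contra qp => /eqP ->; apply: (subvP (addvSr _ _)); exact: memv_line.
Qed.

Lemma meets_at_one_point_line A B v :
  v != 0 -> (A :&: B)%VS = <[v]>%VS -> meets_at_one_point A B.
Proof.
move=> v0 AB; exists <[v]>%VS; split.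
  have /andP[vA vB] : (v \in A) && (v \in B) by rewrite -memv_cap AB memv_line.
  by split; split; rewrite -?memvE // /is_point dim_vline v0.
move=> p [[dp pA] [_ pB]]; apply/esym/eqP.
by rewrite eqEdim -AB subv_cap pA pB AB dim_vline v0 dp.
Qed.

(** As the list is finite, an injective [F] that maps its members to members
    permutes them; so every point of the union is the image of one. *)
Lemma invariant_points_union (G : 'End(T) -> Prop) (s : seq {vspace T}) :
    (forall F, G F -> lker F = 0%VS) ->
    (forall F A, G F -> A \in s -> (F @: A)%VS \in s) ->
  is_invariant G (points_union s).
Proof.
move=> inj_G stable F GF; have /eqP ker0 := inj_G F GF.
have dimF A : \dim (F @: A) = \dim A by apply: limg_dim_eq; rewrite (eqP ker0) capv0.
have inj_img : injective (lfun_img F).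
  move=> A B AB; apply/vspaceP => x; apply/idP/idP => [xA|xB].
    have : F x \in (F @: B)%VS by rewrite -AB memv_img.
    by case/memv_imgP=> y yB /(lker0P ker0) ->.
  have : F x \in (F @: A)%VS by rewrite AB memv_img.
  by case/memv_imgP=> y yA /(lker0P ker0) ->.
have onto B : B \in s -> exists2 A, A \in s & B = (F @: A)%VS.
  pose t := map (lfun_img F) (undup s).
  have ut : uniq t by rewrite map_inj_uniq // undup_uniq.
  have ts : {subset t <= undup s}.
    by move=> _ /mapP[A As ->]; rewrite mem_undup stable // -mem_undup.
  have [|_ eqt] := uniq_min_size ut ts; first by rewrite size_map.
  by rewrite -mem_undup -eqt => /mapP[A As ->]; exists A; rewrite // -mem_undup.
move=> q; split=> [[B /onto[A As ->] [dq qA]]|[p [A As [dp pA]] ->]].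
  have /pointP[y y0 qE] := dq; move: qA; rewrite qE -memvE => /memv_imgP[x xA yE].
  have x0 : x != 0 by apply: contraNneq y0 => x0; rewrite yE x0 linear0.
  exists <[x]>%VS; last by rewrite limg_line yE.
  by exists A => //; split; rewrite -?memvE // /is_point dim_vline x0.
by exists (F @: A)%VS; [exact: stable | split; rewrite ?limgS // /is_point dimF].
Qed.

End ProjectiveLemmas.

Lemma extend_vspace_pair (K : fieldType) (L : fieldExtType K) (TV : vectType K)
    (TW : vectType L) (j : TV -> TW) (p q : TV) : base_linear j ->
  extend_vspace j (<[p]> + <[q]>)%VS = (<[j p]> + <[j q]>)%VS.
Proof.
move=> lin_j; set A := (<[p]> + <[q]>)%VS; set B := (_ + _)%VS.
have jA v : v \in A -> j v \in extend_vspace j A.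
  move/coord_vbasis => ->; rewrite (base_linear_sum lin_j).
  apply: memv_suml => i _; rewrite (base_linearZ lin_j) memvZ //.
  have vi : (vbasis A)`_i \in vbasis A by rewrite mem_nth ?size_tuple.
  rewrite /extend_vspace (big_rem _ vi) /=.
  by apply: (subvP (addvSl _ _)); apply: memv_line.
apply/eqP; rewrite eqEsubv subv_add -!memvE; apply/and3P; split; last 2 first.
- by apply/jA/(subvP (addvSl _ _))/memv_line.
- by apply/jA/(subvP (addvSr _ _))/memv_line.
rewrite /extend_vspace big_seq.
apply: (big_ind (fun X => (X <= B)%VS)) => [|X Y XB YB|v /vbasis_mem].
- exact: sub0v.
- by rewrite subv_add XB.
case/memv_addP=> _ /vlineP[c ->] [_ /vlineP[d ->] ->].
rewrite -memvE (base_linearD lin_j) !(base_linearZ lin_j).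
by apply: memv_add; apply: memvZ; apply: memv_line.
Qed.

Section CoordinateSubspaces.
Variables (K : fieldType) (I : finType) (T : vectType K).
Variables (u : I -> T) (g : I -> 'Hom(T, K^o)).
Hypothesis frame : dual_frame u g.
Implicit Types (P Q : pred I) (F : 'End(T)).

Lemma frame_coord i l : g i (u l) = (i == l)%:R.
Proof. by have [-> _] := frame. Qed.

Lemma frame_inj x y : (forall i, g i x = g i y) -> x = y.
Proof.
move=> gxy; have [_ expand] := frame.
by rewrite (expand x) (expand y); apply: eq_bigr => i _; rewrite gxy.
Qed.

Lemma frame_sum (a : I -> K) i : g i (\sum_l a l *: u l) = a i.
Proof.
rewrite linear_sum (bigD1 i) //= big1 ?addr0 => [|l li].
  by rewrite linearZ /= frame_coord eqxx [LHS]mulr1.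
by rewrite linearZ /= frame_coord eq_sym (negPf li) [LHS]mulr0.
Qed.

Lemma frame_neq0 i : u i != 0.
Proof.
apply/negP => /eqP ui0; have := frame_coord i i.
by rewrite ui0 linear0 eqxx => /eqP; rewrite eq_sym oner_eq0.
Qed.

(** Both parity subspaces and the lines joining opposite basis points have
    this form, for a frame permuted by the group up to scalars and by
    conjugation; their incidences then reduce to those of the index sets. *)
Definition cspan P : {vspace T} := (\sum_(i | P i) <[u i]>)%VS.

Lemma mem_cspan P y : reflect (forall i, ~~ P i -> g i y = 0) (y \in cspan P).
Proof.
apply: (iffP memv_sumP) => [[v vu ->] i Pi|gy].
  rewrite linear_sum big1 // => l Pl; have /vlineP[c ->] := vu l Pl.
  rewrite linearZ /= frame_coord; case: eqP => [il|_]; last by rewrite [LHS]mulr0.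
  by rewrite il Pl in Pi.
exists (fun i => g i y *: u i) => [i _|]; first by rewrite memvZ ?memv_line.
have [_ expand] := frame; rewrite [LHS]expand [LHS](bigID P) /= [X in _ + X]big1 ?addr0 //.
by move=> i /gy ->; rewrite scale0r.
Qed.

Lemma eq_cspan P Q : P =1 Q -> cspan P = cspan Q.
Proof. by move=> PQ; apply: eq_bigl. Qed.

Lemma mem_cspan_frame P i : (u i \in cspan P) = P i.
Proof.
apply/mem_cspan/idP => [h|Pi l Pl].
  by apply/negPn/negP => /h/eqP; rewrite frame_coord eqxx oner_eq0.
by rewrite frame_coord; case: eqP => // li; rewrite li Pi in Pl.
Qed.

Lemma cspanS P Q : (forall i, P i -> Q i) -> (cspan P <= cspan Q)%VS.
Proof. by move=> PQ; apply/subv_sumP => i /PQ Qi; rewrite -memvE mem_cspan_frame. Qed.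

Lemma cspan_cap P Q : (cspan P :&: cspan Q)%VS = cspan (predI P Q).
Proof.
apply/vspaceP => y; rewrite memv_cap.
apply/andP/mem_cspan => [[/mem_cspan yP /mem_cspan yQ] i|yPQ].
  by rewrite negb_and => /orP[/yP|/yQ].
by split; apply/mem_cspan => i Ni; apply: yPQ; rewrite negb_and Ni ?orbT.
Qed.

Lemma cspan_pred0 P : (forall i, P i = false) -> cspan P = 0%VS.
Proof. by move=> P0; apply: big_pred0. Qed.

Lemma cspan_pred1 i : cspan (pred1 i) = <[u i]>%VS.
Proof. exact: big_pred1_eq. Qed.

Lemma cspan_pred2 i l : i != l -> cspan (pred2 i l) = (<[u i]> + <[u l]>)%VS.
Proof.
move=> il; rewrite /cspan (bigD1 i) /= ?eqxx //; congr (_ + _)%VS.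
by apply: big_pred1 => k /=; case: (eqVneq k i) => [->|] /=; rewrite ?(negPf il) ?andbT.
Qed.

Lemma dim_cspan_pred2 i l : i != l -> \dim (cspan (pred2 i l)) = 2%N.
Proof.
move=> il; rewrite cspan_pred2 // dimv_disjoint_sum ?dim_vline ?frame_neq0 //.
rewrite -!cspan_pred1 cspan_cap cspan_pred0 // => k /=.
by case: eqP => // ->; rewrite (negPf il).
Qed.

Lemma cspan_meets P Q i : (forall l, P l && Q l = (l == i)) ->
  meets_at_one_point (cspan P) (cspan Q).
Proof.
move=> PQ; apply: (meets_at_one_point_line (frame_neq0 i)).
by rewrite cspan_cap -cspan_pred1; apply: eq_cspan.
Qed.

Variables (F : 'End(T)) (pi : I -> I) (c : I -> K).
Hypotheses (pi_inj : injective pi) (c_neq0 : forall i, c i != 0).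
Hypothesis FE : forall i, F (u (pi i)) = c i *: u i.

Lemma monomial_coord i x : g i (F x) = c i * g (pi i) x.
Proof.
have [_ expand] := frame; rewrite {1}(expand x) !linear_sum /= (reindex_inj pi_inj).
rewrite (bigD1 i) //= big1 ?addr0 => [|l li]; rewrite !linearZ /= FE linearZ /= frame_coord.
  by rewrite eqxx [X in _ *: X]mulr1 mulrC.
by rewrite eq_sym (negPf li) [X in _ *: X]mulr0 scaler0.
Qed.

Lemma monomial_lker : lker F = 0%VS.
Proof.
apply/eqP; rewrite -subv0; apply/subvP => x; rewrite memv_ker memv0 => /eqP Fx0.
apply/eqP/frame_inj => l; rewrite linear0.
have [pi' _ pi'K] := injF_bij pi_inj.
have := monomial_coord (pi' l) x; rewrite Fx0 linear0 pi'K => /esym/eqP.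
by rewrite mulf_eq0 (negPf (c_neq0 _)) => /eqP.
Qed.

Lemma monomial_img P : (F @: cspan P)%VS = cspan (fun i => P (pi i)).
Proof.
rewrite limg_sum (reindex_inj pi_inj); apply: eq_bigr => i _.
by rewrite limg_line FE scale_line.
Qed.

End CoordinateSubspaces.

(** * The invariant basis and the stabiliser of the Segre variety *)

Section InvariantFrame.
Variables (F4 : fieldExtType 'F_2) (w : F4).
Hypotheses (hF4 : \dim {: F4} = 2%N) (hw : w ^+ 2 + w + 1 = 0).
Variables (m : nat) (k1 : 'I_m) (V : 'I_m -> vectType 'F_2).
Variables (TV : vectType 'F_2) (tV : (forall k, V k) -> TV).
Hypothesis hTV : is_tensor_product tV.
Variables (TW : vectType F4) (j : TV -> TW).
Hypothesis lin_j : base_linear j.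
(** [zc k] is the coordinate that identifies [V k] with the field of four
    elements, and [zi k] is its inverse. *)
Variables (zc : forall k, V k -> F4) (zi : forall k, F4 -> V k).
Arguments zi : clear implicits.
Hypotheses (zcK : forall k, cancel (@zc k) (zi k)) (ziK : forall k, cancel (zi k) (@zc k)).
Hypothesis zcD : forall k (x y : V k), zc (x + y) = zc x + zc y.
(** Three frames are used: a basis of [TV], the basis of [TW] that it induces,
    which computes conjugation and real points, and the invariant basis. *)
Variables (E : mindex m -> TV) (gE : mindex m -> 'Hom(TV, ('F_2)^o)).
Hypothesis frameE : dual_frame E gE.
Hypothesis E_tensor : forall l, exists a, E l = tV a.
Variable gR : mindex m -> 'Hom(TW, F4^o).
Hypothesis frameR : dual_frame (fun l => j (E l)) gR.
Variables (U : mindex m -> TW) (g : mindex m -> 'Hom(TW, F4^o)).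
Hypothesis frameU : dual_frame U g.
Hypothesis tensor_coord : forall i a, g i (j (tV a)) = chi i (fun k => zc (a k)).

Variable cconj : TW -> TW.
Hypothesis hconj : is_conjugation j cconj.

Implicit Types (i l s : mindex m) (zeta : 'I_m -> F4) (a b : forall k, V k) (F : 'End(TW)).

Lemma zc_eq0 k (x : V k) : (zc x == 0) = (x == 0).
Proof.
have zc0 : zc (0 : V k) = 0 by apply: (addrI (zc (0 : V k))); rewrite -zcD !addr0.
by apply/eqP/eqP => [z0|->//]; rewrite -(zcK x) z0 -zc0 zcK.
Qed.

Lemma nonvanishing_zc a : (forall k, a k != 0) -> nonvanishing (fun k => zc (a k)).
Proof. by move=> a0 k; rewrite zc_eq0. Qed.

Lemma zi_neq0 (z : 'I_m -> F4) : nonvanishing z -> forall k, zi k (z k) != 0.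
Proof. by move=> z0 k; rewrite -zc_eq0 ziK. Qed.

Lemma chi_zi i (z : 'I_m -> F4) : chi i (fun k => zc (zi k (z k))) = chi i z.
Proof. by apply: eq_bigr => k _; rewrite ziK. Qed.

Lemma tensor_neq0 a : (forall k, a k != 0) -> tV a != 0.
Proof.
move=> a0; apply/negP => /eqP ta0.
have := chi_neq0 [ffun=> false] (nonvanishing_zc a0).
by rewrite -tensor_coord ta0 (base_linear0 lin_j) linear0 eqxx.
Qed.

Lemma tensor_expand a : j (tV a) = \sum_i chi i (fun k => zc (a k)) *: U i.
Proof. by apply: (frame_inj frameU) => i; rewrite tensor_coord (frame_sum frameU). Qed.

Lemma base_linear_frame_eq (U' : vectType F4) (h h' : TV -> U') :
  base_linear h -> base_linear h' -> (forall l, h (E l) = h' (E l)) -> h =1 h'.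
Proof.
move=> lh lh' hh v; have [_ expand] := frameE.
rewrite (expand v) (base_linear_sum lh) (base_linear_sum lh').
by apply: eq_bigr => l _; rewrite (base_linearZ lh) (base_linearZ lh') hh.
Qed.

(** A point over F_2 contains a single nonzero vector; so the elements of the
    stabiliser, defined by their action on points, map pure tensors to pure
    tensors. *)
Lemma line_F2 (x y : TV) : y != 0 -> <[x]>%VS = <[y]>%VS -> y = x.
Proof.
move=> y0 /(eq_line_scale y0) [c c0 ->].
have [c00|->] := F2_cases c; last by rewrite scale1r.
by rewrite c00 eqxx in c0.
Qed.

Lemma segre_tensor a : (forall k, a k != 0) -> segre tV <[tV a]>%VS.
Proof. by move=> a0; exists a. Qed.

Lemma stabiliser_tensor f a : segre_stabiliser tV f -> (forall k, a k != 0) ->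
  exists2 b, forall k, b k != 0 & f (tV a) = tV b.
Proof.
move=> [_ onto] /segre_tensor sa.
have /onto[b b0] : exists2 p, segre tV p & (f @: <[tV a]>)%VS = (f @: p)%VS.
  by exists <[tV a]>%VS.
by rewrite limg_line => /(line_F2 (tensor_neq0 b0)) tb; exists b.
Qed.

Lemma stabiliser_tensor_onto f b : segre_stabiliser tV f -> (forall k, b k != 0) ->
  exists2 a, forall k, a k != 0 & f (tV a) = tV b.
Proof.
move=> [_ onto] b0; have /onto[_ [a a0 ->]] := segre_tensor b0.
by rewrite limg_line => /esym/(line_F2 (tensor_neq0 b0)) tb; exists a.
Qed.

(** In the coordinates [z] the map [F] sends pure tensors onto pure tensors,
    so that its matrix in the invariant basis satisfies the hypotheses of
    [matrix_signed_perm]. *)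
Lemma segre_group_monomial F : segre_group tV j F ->
  exists tau s c, (forall i, c i != 0) /\
    forall i, F (U (signed_perm tau s i)) = c i *: U i.
Proof.
move=> [f stab_f jF].
have FE i a b : f (tV a) = tV b -> \sum_l g i (F (U l)) * chi l (fun k => zc (a k)) =
    chi i (fun k => zc (b k)).
  move=> fab; rewrite -tensor_coord -fab -jF tensor_expand !linear_sum.
  by apply: eq_bigr => l _; rewrite !linearZ /= mulrC.
have [z z0|z z0|tau [s [c [c0 ME]]]] :=
    matrix_signed_perm hF4 hw (M := fun i l => g i (F (U l))).
- have [b b0 fb] := stabiliser_tensor stab_f (zi_neq0 z0).
  exists (fun k => zc (b k)) => [|i]; first exact: nonvanishing_zc.
  by rewrite -(FE _ _ _ fb); apply: eq_bigr => l _; rewrite chi_zi.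
- have [a a0 fa] := stabiliser_tensor_onto stab_f (zi_neq0 z0).
  exists (fun k => zc (a k)) => [|i]; first exact: nonvanishing_zc.
  by rewrite (FE _ _ _ fa) chi_zi.
exists tau, s, c; split=> // i; apply: (frame_inj frameU) => l.
rewrite ME linearZ /= (frame_coord frameU) (inj_eq (@signed_perm_inj _ _ _)) eq_sym.
by case: eqP => [->|_]; [rewrite [RHS]mulr1 | rewrite [RHS]mulr0].
Qed.

Lemma segre_group_ker F : segre_group tV j F -> lker F = 0%VS.
Proof.
case/segre_group_monomial=> tau [s [c [c0 FU]]].
exact: (monomial_lker frameU (@signed_perm_inj _ tau s) c0 FU).
Qed.

Definition parity_span (e : bool) := cspan U (fun i => odd_index i == e).

Definition opposite_pair i : pred (mindex m) := pred2 i (opposite i).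

Definition pair_line i := cspan U (opposite_pair i).

(** The parity of a vertex is the sum of its entries; permuting them and
    adding a constant vector changes it by a constant. *)
Lemma segre_group_parity_span F : segre_group tV j F ->
  exists e0, forall e, (F @: parity_span e)%VS = parity_span (e (+) e0).
Proof.
case/segre_group_monomial=> tau [s [c [c0 FU]]]; exists (odd_index s) => e.
rewrite (monomial_img (@signed_perm_inj _ tau s) c0 FU); apply: eq_cspan => i.
by rewrite odd_index_signed_perm; case: (odd_index i) (odd_index s) e => [] [] [].
Qed.

Lemma oppositeK : involutive (@opposite m).
Proof. by move=> i; apply/ffunP => k; rewrite !ffunE negbK. Qed.

Lemma opposite_neq i : i != opposite i.
Proof. by apply/eqP => /ffunP/(_ k1); rewrite ffunE; case: (i k1). Qed.

Lemma pair_line_opposite i : pair_line (opposite i) = pair_line i.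
Proof. by apply: eq_cspan => l; rewrite /opposite_pair /= oppositeK orbC. Qed.

Definition pair_lines : seq {vspace TW} :=
  [seq pair_line i | i : mindex m <- enum {: mindex m} & ~~ i k1].

Lemma mem_pair_lines i : pair_line i \in pair_lines.
Proof.
case ik : (i k1); last by apply: map_f; rewrite mem_filter ik mem_enum.
rewrite -pair_line_opposite; apply: map_f.
by rewrite mem_filter ffunE ik mem_enum.
Qed.

Lemma pair_linesP A : A \in pair_lines -> exists2 i : mindex m, ~~ i k1 & A = pair_line i.
Proof. by case/mapP => i; rewrite mem_filter => /andP[ik _] ->; exists i. Qed.

Lemma segre_group_pair_lines F A :
  segre_group tV j F -> A \in pair_lines -> (F @: A)%VS \in pair_lines.
Proof.
case/segre_group_monomial=> tau [s [c [c0 FU]]] /pair_linesP[i _ ->].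
have [pi' _ piK] := injF_bij (@signed_perm_inj _ tau s).
rewrite -(piK i) (monomial_img (@signed_perm_inj _ tau s) c0 FU).
set l := pi' i; rewrite (eq_cspan U (Q := opposite_pair l)) ?mem_pair_lines // => k.
by rewrite /opposite_pair /= -signed_perm_opposite !(inj_eq (@signed_perm_inj _ _ _)).
Qed.

Lemma conj_sum (a : mindex m -> F4) (v : mindex m -> TV) :
  cconj (\sum_l a l *: j (v l)) = \sum_l a l ^+ 2 *: j (v l).
Proof.
have [cD cZ cj] := hconj.
have c0 : cconj 0 = 0 by apply: (addrI (cconj 0)); rewrite -cD !addr0.
by rewrite (big_morph cconj cD c0); apply: eq_bigr => l _; rewrite cZ cj.
Qed.

(** Conjugation squares the coefficients in the real basis, and for a pure
    tensor the coefficients at [i] and [i'] are conjugate; hence the matrix of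
    base change intertwines conjugation with [i |-> i'] followed by squaring.
    *)
Lemma conj_coord i y : g (opposite i) (cconj y) = g i y ^+ 2.
Proof.
have [_ expand] := frameR; rewrite (expand y) conj_sum !linear_sum /=.
rewrite [RHS](big_morph (fun x : F4 => x ^+ 2) (@sqrD_F4 F4) (expr0n _ 2)).
apply: eq_bigr => l _; rewrite !linearZ /=.
have [a ->] := E_tensor l.
by rewrite !tensor_coord (chi_opposite hF4 hw); exact: esym (exprMn _ _ _).
Qed.

Lemma conjK : involutive cconj.
Proof.
move=> y; apply: (frame_inj frameU) => i.
by rewrite -[i]oppositeK !conj_coord (expF4_4 hF4 hw) oppositeK.
Qed.

Lemma conjugate_cspan (P Q : pred (mindex m)) :
  (forall i, Q i = P (opposite i)) -> conjugate_subspaces cconj (cspan U P) (cspan U Q).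
Proof.
move=> QP; have conj_mem y : y \in cspan U Q -> cconj y \in cspan U P.
  move/(mem_cspan frameU) => yQ; apply/(mem_cspan frameU) => i Pi.
  rewrite -[i]oppositeK conj_coord yQ ?expr0n // QP oppositeK //.
move=> y; split=> [yQ|[x /(mem_cspan frameU) xP ->]].
  by exists (cconj y); rewrite ?conjK // conj_mem.
apply/(mem_cspan frameU) => i; rewrite QP => /xP gx.
by rewrite -[i]oppositeK conj_coord gx expr0n.
Qed.

(** The coefficients in the real basis are fixed by squaring, so they are 0 or
    1. *)
Lemma real_vector y : cconj y = y -> exists v, y = j v.
Proof.
have [_ expand] := frameR; move=> cy.
have sq l : gR l y ^+ 2 = gR l y.
  have := frame_sum frameR (fun l => gR l y ^+ 2) l.
  by rewrite -conj_sum -expand cy.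
exists (\sum_l (gR l y != 0)%:R *: E l); rewrite (base_linear_sum lin_j).
rewrite [LHS]expand; apply: eq_bigr => l _; rewrite (base_linearZ lin_j).
have := sq l; have [-> _|nz] := eqVneq (gR l y) 0; first by rewrite !scale0r.
by rewrite expr2 -[RHS]mulr1 => /(mulfI nz) ->; rewrite !scale1r.
Qed.

(** The vectors of the line through [U i] and [U i'] fixed by conjugation. *)
Definition real_vec i (c : F4) : TW := c *: U i + c ^+ 2 *: U (opposite i).

Lemma real_vec_coord i c l : g l (real_vec i c) =
  if l == i then c else if l == opposite i then c ^+ 2 else 0.
Proof.
rewrite linearD !linearZ /= !(frame_coord frameU).
have [->|li] := eqVneq l i.
  by rewrite (negPf (opposite_neq i)) [X in X + _]mulr1 [X in _ + X]mulr0 addr0.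
by case: eqP => _; rewrite [X in X + _]mulr0 ?[X in _ + X]mulr1 ?[X in _ + X]mulr0 add0r.
Qed.

Lemma real_vec_neq0 i c : c != 0 -> real_vec i c != 0.
Proof.
move=> c0; apply/negP => /eqP r0; have := real_vec_coord i c i.
by rewrite r0 linear0 eqxx => /esym/eqP; rewrite (negPf c0).
Qed.

Lemma conj_real_vec i c : cconj (real_vec i c) = real_vec i c.
Proof.
apply: (frame_inj frameU) => l; rewrite -[l]oppositeK conj_coord !real_vec_coord.
rewrite (inj_eq (can_inj oppositeK)) -[opposite l == i](inj_eq (can_inj oppositeK)) oppositeK.
have [->|li] := eqVneq l i; first by rewrite (negPf (opposite_neq i)) (expF4_4 hF4 hw).
by case: eqP => // _; rewrite expr0n.
Qed.

(** The condition on [k1] excludes [l = i'], the only other index giving the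
    same line; and a scalar [x] between two such vectors is fixed by squaring.
    *)
Lemma real_vec_inj i l c d : ~~ i k1 -> ~~ l k1 -> c != 0 -> d != 0 ->
  <[real_vec i c]>%VS = <[real_vec l d]>%VS -> i = l /\ c = d.
Proof.
move=> ik lk c0 d0 /(eq_line_scale (real_vec_neq0 l d0)) [x x0 vE].
have coord k : g k (real_vec l d) = x * g k (real_vec i c) by rewrite vE linearZ.
have il : i = l.
  have := coord l; rewrite !real_vec_coord eqxx; case: eqP => // _.
  case: eqP => [lo|_ dE]; first by move: lk; rewrite lo ffunE ik.
  by move: d0; rewrite dE mulr0 eqxx.
split=> //; have := coord l; have := coord (opposite l).
rewrite il !real_vec_coord eqxx [_ == l]eq_sym (negPf (opposite_neq l)) eqxx => d2 d1.
have : x * c ^+ 2 = x ^+ 2 * c ^+ 2 by rewrite -d2 d1 exprMn.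
move/(mulIf (expf_neq0 2 c0)); rewrite expr2 -[LHS]mulr1 => /(mulfI x0) x1.
by rewrite d1 -x1 mul1r.
Qed.

Lemma real_point_pair_line i p :
  (real_point j p /\ points (pair_line i) p) <->
  exists2 c, c != 0 & p = <[real_vec i c]>%VS.
Proof.
have [_ _ cj] := hconj.
split=> [[[v v0 ->] [dp]]|[c c0 ->]]; last first.
  have r0 := real_vec_neq0 i c0; split.
    have [v rv] := real_vector (conj_real_vec i c); exists v; last by rewrite rv.
    by apply: contraNneq r0 => v0; rewrite rv v0 (base_linear0 lin_j).
  split; first by rewrite /is_point dim_vline r0.
  rewrite -memvE; apply/(mem_cspan frameU) => l; rewrite negb_or real_vec_coord.
  by case/andP=> /negPf -> /negPf ->.
rewrite -memvE => /(mem_cspan frameU) jv; exists (g i (j v)).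
  apply: contraTneq isT => gv0; move: dp; rewrite /is_point dim_vline.
  suff -> : j v = 0 by rewrite eqxx.
  apply: (frame_inj frameU) => l; rewrite linear0.
  case: (boolP (opposite_pair i l)) => [|/jv //].
  by case/orP=> /eqP -> //; rewrite -(cj v) conj_coord gv0 expr0n.
congr <[_]>%VS; apply: (frame_inj frameU) => l; rewrite real_vec_coord.
case: eqP => [-> //|/eqP li]; case: eqP => [->|/eqP lo].
  by rewrite -[in LHS](cj v) conj_coord.
by apply: jv; rewrite /opposite_pair /= negb_or li lo.
Qed.


(** * Real points on the lines of opposite basis points *)

(** Passing to the opposite index exchanges the indices with a 0 and with a 1
    in the position [k1]. *)
Lemma size_pair_lines : size pair_lines = (2 ^ m.-1)%N.
Proof.
rewrite size_map -sum1_size big_filter big_enum_cond sum1_card.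
pose N (b : bool) := #|[pred i : mindex m | i k1 == b]|.
have half : N true = N false.
  rewrite /N -(card_image (can_inj oppositeK)); apply: eq_card => i.
  apply/imageP/idP => [[l + ->]|]; first by rewrite !inE ffunE => /eqP ->.
  by rewrite !inE => ik; exists (opposite i); rewrite ?oppositeK // inE ffunE (eqP ik).
have total : (N true + N false = 2 ^ m)%N.
  have := cardC [pred i : mindex m | i k1 == true].
  rewrite card_ffun card_bool card_ord => <-; congr (_ + _)%N.
  by apply: eq_card => i; rewrite !inE; case: (i k1).
have -> : #|[pred i : mindex m | ~~ i k1]| = N false.
  by apply: eq_card => i; rewrite !inE; case: (i k1).
have m0 : (0 < m)%N by case: (m) k1 => // -[].
move: total; rewrite half addnn -[in X in (2 ^ X)%N](prednK m0) expnS mul2n.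
exact: double_inj.
Qed.

Lemma uniq_indices : uniq [seq i : mindex m <- enum {: mindex m} | ~~ i k1].
Proof. by apply: filter_uniq; apply: enum_uniq. Qed.

Lemma uniq_pair_lines : uniq pair_lines.
Proof.
rewrite map_inj_in_uniq ?uniq_indices // => i l.
rewrite !mem_filter => /andP[ik _] /andP[lk _] il.
have : U i \in pair_line l by rewrite -il (mem_cspan_frame frameU) /opposite_pair /= eqxx.
rewrite (mem_cspan_frame frameU) => /orP[/eqP //|/eqP ilo].
by move: ik; rewrite ilo ffunE lk.
Qed.

Lemma pair_lines_skew A B : A \in pair_lines -> B \in pair_lines -> A != B ->
  skew_subspaces A B.
Proof.
move=> /pair_linesP[i ik ->] /pair_linesP[l lk ->] AB.
rewrite /skew_subspaces (cspan_cap frameU) cspan_pred0 // => h.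
apply/negP => /andP[hi hl]; case/eqP: AB.
have : pair_line i = pair_line h /\ pair_line l = pair_line h.
  by split; [case/orP: hi | case/orP: hl] => /eqP ->; rewrite ?pair_line_opposite.
by case=> -> ->.
Qed.

Definition real_vecs : seq {vspace TW} :=
  [seq <[real_vec i c]>%VS | i <- [seq i : mindex m <- enum {: mindex m} | ~~ i k1],
                             c <- [:: 1; w; w ^+ 2]].

Lemma root_of_unity_neq0 (c : F4) : c \in [:: 1; w; w ^+ 2] -> c != 0.
Proof.
by rewrite !inE => /or3P[] /eqP->; rewrite ?oner_neq0 ?expf_neq0 ?(omega_neq0 hw).
Qed.

Lemma real_points_enum p :
  p \in real_vecs <-> real_point j p /\ points_union pair_lines p.
Proof.
split=> [/allpairsP[[i c] /= [_ hc ->]]|[rp [A /pair_linesP[i ik ->] pA]]].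
  have c0 := root_of_unity_neq0 hc.
  have [rp pi] := proj2 (real_point_pair_line i _) (ex_intro2 _ _ c c0 erefl).
  by split=> //; exists (pair_line i); rewrite ?mem_pair_lines.
have [c c0 ->] := proj1 (real_point_pair_line i p) (conj rp pA).
apply/allpairsP; exists (i, c); split=> //=; first by rewrite mem_filter ik mem_enum.
rewrite !inE; have [c00|->|->|->] := F4_cases hF4 hw c; rewrite ?eqxx ?orbT //.
by rewrite c00 eqxx in c0.
Qed.

Lemma real_points_size :
  has_size (fun p => real_point j p /\ points_union pair_lines p) (3 * size pair_lines)%N.
Proof.
exists real_vecs; last exact: real_points_enum.
split; last by rewrite size_allpairs size_map mulnC.
apply: allpairs_uniq; rewrite ?uniq_indices //.
  rewrite /= !inE negb_or eq_sym (omega_neq1 hw) eq_sym (omega_sqr_neq1 hw).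
  by rewrite (omega_neq_sqr hw).
move=> [i c] [l d] /allpairsP[[i' c'] [hi hc [-> ->]]] /allpairsP[[l' d'] [hl hd [-> ->]]].
move: hi hl hc hd => /=; rewrite !mem_filter => /andP[ik _] /andP[lk _] hc hd.
by case/(real_vec_inj ik lk (root_of_unity_neq0 hc) (root_of_unity_neq0 hd)) => -> ->.
Qed.

Lemma tensor_map_multilinear (h : forall k, V k -> V k) :
  (forall k x y, h k (x + y) = h k x + h k y) -> multilinear (fun a => tV (fun k => h k (a k))).
Proof.
move=> hD a k c x y.
have h0 : h k 0 = 0 by apply: (addrI (h k 0)); rewrite -hD !addr0.
have hZ (d : 'F_2) z : h k (d *: z) = d *: h k z.
  by have [->|->] := F2_cases d; rewrite ?scale0r ?scale1r.
have hE z : tV (fun k' => h k' (dfwith (T := V) a z k')) =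
    tV (dfwith (T := V) (fun k' => h k' (a k')) (h k z)).
  congr tV; apply: functional_extensionality_dep => l.
  by case: dfwithP => [|l' kl']; rewrite ?dfwith_in ?dfwith_out.
by rewrite !hE hD hZ (proj1 hTV).
Qed.

Lemma ziD k x y : zi k (x + y) = zi k x + zi k y.
Proof. by apply: (can_inj (@zcK k)); rewrite zcD !ziK. Qed.

(** The product of one collineation in each factor: multiplication of the
    coordinate by [zeta k], followed by conjugation of the coordinate if [s
    k]. Conjugation is linear over F_2. *)
Definition rescale (s : mindex m) (zeta : 'I_m -> F4) a k : V k :=
  zi k (twist (s k) (zeta k * zc (a k))).

Lemma rescale_lfun s zeta : exists f : 'End(TV), forall a, f (tV a) = tV (rescale s zeta a).
Proof.
have [_ univ] := hTV; have [|f [fE _]] := univ _ (fun a => tV (rescale s zeta a)).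
  apply: (@tensor_map_multilinear (fun k x => zi k (twist (s k) (zeta k * zc x)))) => k x y.
  by rewrite zcD mulrDr twistD ziD.
by exists f.
Qed.

Lemma rescale_neq0 s zeta a : nonvanishing zeta -> (forall k, a k != 0) ->
  forall k, rescale s zeta a k != 0.
Proof.
by move=> zeta0 a0 k; rewrite -zc_eq0 ziK twist_eq0 mulf_eq0 zc_eq0 negb_or zeta0 a0.
Qed.

(** The inverse has the same form because conjugation is an involution that
    commutes with inversion. *)
Lemma rescaleK s zeta : nonvanishing zeta ->
  let zeta' k := twist (s k) (zeta k)^-1 in
  nonvanishing zeta' /\ (forall a, rescale s zeta (rescale s zeta' a) = a) /\
  (forall a, rescale s zeta' (rescale s zeta a) = a).
Proof.
move=> zeta0 zeta'; split=> [k|]; first by rewrite twist_eq0 invr_eq0 zeta0.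
have z0 k : zeta k != 0 by apply: zeta0.
split=> a; apply: functional_extensionality_dep => k; apply: (can_inj (@zcK k)).
  rewrite !ziK twistM (twist_twist hF4 hw) addbb /= mulrA /zeta'.
  by rewrite -twistM (mulfV (z0 k)) twist1 mul1r.
by rewrite !ziK twistM !(twist_twist hF4 hw) addbb /= (mulKf (z0 k)).
Qed.

Lemma rescale_stabiliser s zeta (f : 'End(TV)) : nonvanishing zeta ->
  (forall a, f (tV a) = tV (rescale s zeta a)) -> segre_stabiliser tV f.
Proof.
move=> zeta0 fE; have /= [zeta'0 [K K']] := rescaleK s zeta0.
have [f1 f1E] := rescale_lfun s (fun k => twist (s k) (zeta k)^-1).
have fK : (f1 \o f)%VF = \1%VF.
  by apply: (tensor_lfun_eq hTV) => a; rewrite comp_lfunE fE f1E K' id_lfunE.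
split.
  apply/eqP/lker0P; apply: (can_inj (g := f1)) => x.
  by have := congr1 (fun h : 'End(TV) => h x) fK; rewrite /= comp_lfunE id_lfunE.
move=> q; split=> [[b b0 ->]|[_ [a a0 ->] ->]]; last first.
  by rewrite limg_line fE; apply: segre_tensor; apply: rescale_neq0.
exists <[tV (rescale s (fun k => twist (s k) (zeta k)^-1) b)]>%VS.
  by apply: segre_tensor; apply: rescale_neq0.
by rewrite limg_line fE K.
Qed.

Definition add_index s i : mindex m := [ffun k => i k (+) s k].

(** Conjugating the coordinate [k] exchanges u_0 and u_1 in [W k], and
    rescaling it multiplies them by [zeta k] and its conjugate. *)
Lemma rescale_group s zeta : nonvanishing zeta ->
  exists2 F, segre_group tV j F & forall l, F (U l) = chi l zeta *: U (add_index s l).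
Proof.
move=> zeta0; have [f fE] := rescale_lfun s zeta.
have [F FE] := expansion_lfun (fun l => chi l zeta *: U (add_index s l)) g.
have FU l : F (U l) = chi l zeta *: U (add_index s l).
  rewrite FE (bigD1 l) //= big1 => [|i /negPf il]; rewrite (frame_coord frameU).
    by rewrite eqxx scale1r addr0.
  by rewrite il scale0r.
exists F => //; exists f; first exact: rescale_stabiliser fE.
apply: base_linear_frame_eq => [||l].
- exact: base_linear_comp.
- by move=> c x y; rewrite linearP lin_j.
have [a ->] := E_tensor l.
have addK : involutive (add_index s).
  by move=> i; apply/ffunP => k; rewrite !ffunE -addbA addbb addbF.
rewrite fE !tensor_expand linear_sum /= [RHS](reindex_inj (can_inj addK)).
apply: eq_bigr => i _; rewrite linearZ /= FU scalerA mulrC; congr (_ *: _).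
rewrite -chiM; apply: eq_bigr => k _.
by rewrite ziK ffunE (twist_twist hF4 hw) addbCA addbb addbF.
Qed.

(** The translation by [i] and the rescaling by [c] in the position [k1] take
    [U_0 + U_0'] to [c U_i + c^2 U_i'], as 0 has the entry 0 and its opposite
    the entry 1 in that position. *)
Lemma real_points_orbit :
  is_invariant (segre_group tV j) (points_union pair_lines) ->
  is_orbit (segre_group tV j) (fun p => real_point j p /\ points_union pair_lines p).
Proof.
move=> inv; pose i0 : mindex m := [ffun=> false].
have onL i p : (real_point j p /\ points (pair_line i) p) <->
  exists2 c, c != 0 & p = <[real_vec i c]>%VS by exact: real_point_pair_line.
have r1 := real_vec_neq0 i0 (oner_neq0 F4).
exists <[real_vec i0 1]>%VS; first by rewrite /is_point dim_vline r1.
have [rp0 pp0] := proj2 (onL i0 _) (ex_intro2 _ _ 1 (oner_neq0 _) erefl).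
move=> q; split=> [[rq [A /pair_linesP[i _ ->] pA]]|[F GF ->]]; last first.
  split.
    have [v v0 vE] := rp0; have [f [/eqP/lker0P injf _] jF] := GF.
    exists (f v); first by apply: contraNneq v0 => fv0; apply/eqP/injf; rewrite fv0 linear0.
    by rewrite vE limg_line jF.
  by apply/(inv F GF); exists <[real_vec i0 1]>%VS => //;
     exists (pair_line i0); rewrite ?mem_pair_lines.
have [c c0 ->] := proj1 (onL i q) (conj rq pA).
have [F GF FU] := rescale_group i (point_at_neq0 k1 c0).
exists F => //; rewrite limg_line; congr <[_]>%VS.
have -> : i = add_index i i0 by apply/ffunP => k; rewrite !ffunE addFb.
rewrite /real_vec expr1n !scale1r linearD /= !FU !chi_point !ffunE /=; congr (_ + _ *: U _).
by apply/ffunP => k; rewrite !ffunE addFb addTb.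
Qed.

Lemma odd_index_exists e : exists i : mindex m, odd_index i = e.
Proof.
exists [ffun k => (k == k1) && e]; rewrite odd_index_sum (bigD1 k1) //= ffunE eqxx.
by rewrite big1 ?addbF // => k /negPf kk; rewrite ffunE kk.
Qed.

(** * Distinguished tangents *)

(** Multiplication by [w] is a fixed-point-free rotation of the three nonzero
    vectors of [V k]; so [x] and [turn x] form a basis for every nonzero [x],
    and [turn] provides a second point on each generator. *)
Definition turn k (x : V k) : V k := zi k (w * zc x).

Definition turned a k := tV (dfwith (T := V) a (turn (a k))).

Lemma zc_span k (x y : V k) : x != 0 ->
  exists c d : 'F_2, y = c *: x + d *: turn x.
Proof.
move=> x0; have zx0 : zc x != 0 by rewrite zc_eq0.
have yE : zc y = zc y / zc x * zc x by rewrite divfK.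
suff [c [d e]] : exists c d : 'F_2, zc y = zc (c *: x + d *: turn x).
  by exists c, d; apply: (can_inj (@zcK k)).
have z0 : zc (0 : V k) = 0 by apply/eqP; rewrite zc_eq0.
rewrite yE; have [->|->|->|->] := F4_cases hF4 hw (zc y / zc x).
- by exists 0, 0; rewrite !scale0r addr0 z0 mul0r.
- by exists 1, 0; rewrite scale1r scale0r addr0 mul1r.
- by exists 0, 1; rewrite scale1r scale0r add0r ziK.
by exists 1, 1; rewrite !scale1r zcD ziK (omega_sqr hw) mulrDl mul1r addrC.
Qed.

Lemma segre_generator_span a k y : a k != 0 -> y \in segre_generator tV a k ->
  exists c d : 'F_2, y = c *: tV a + d *: turned a k.
Proof.
move=> ak0 /memv_imgP[x _ ->].
rewrite linear_linfunE => [|c x' y']; last exact: (proj1 hTV).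
have [c [d ->]] := zc_span x ak0; exists c, d.
have [s sE] := multilinear_slot a k (proj1 hTV).
by rewrite -sE linearD !linearZ /= !sE dfwith_id.
Qed.

Lemma mem_segre_generator a k (x : V k) : tV (dfwith (T := V) a x) \in segre_generator tV a k.
Proof.
apply/memv_imgP; exists x; rewrite ?memvf // linear_linfunE // => c x' y'.
exact: (proj1 hTV).
Qed.

(** A vector [q] of the tangent line outside [tV a] is a combination of [tV a]
    and of the vectors [turned a k]. Avoiding the span of all generators but
    the [k]-th one forces a nonzero coefficient at [turned a k], which is 1
    over F_2. *)
Lemma distinguished_tangent_span A : distinguished_tangent tV A ->
  exists2 a, forall k, a k != 0 & A = (<[tV a]> + <[\sum_k turned a k]>)%VS.
Proof.
case=> a [a0 [dimA pA tanA] generic]; exists a => //.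
have p0 := tensor_neq0 a0.
have /subvPn[q qA qp] : ~~ (A <= <[tV a]>)%VS.
  by apply/negP => /dimvS; rewrite dimA dim_vline p0.
have /memv_sumP[y hy qE] := subvP tanA _ qA.
have /fin_all_exists[c] k : exists c : 'F_2, exists d : 'F_2, y k = c *: tV a + d *: turned a k.
  by apply: segre_generator_span => //; apply: hy.
case/fin_all_exists=> d yE.
have {}qE : q = (\sum_k c k) *: tV a + \sum_k d k *: turned a k.
  by rewrite qE scaler_suml -big_split; apply: eq_bigr.
have lineE := line_span dimA p0 pA qA qp.
have d1 k : d k = 1.
  have [dk0|//] := F2_cases (d k); case/negP: (generic k).
  have qE' : q = (\sum_k c k) *: tV a + \sum_(k' | k' != k) d k' *: turned a k'.
    by rewrite qE [X in _ + X](bigD1 k) //= dk0 scale0r add0r.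
  (* The point [tV a] lies in the span of the other generators if there are
     any; for [m = 1] there are none, and [q] would be a multiple of [tV a].
     *)
  have [k' kk'|none] := pickP (fun k' => k' != k); last first.
    by case/negP: qp; rewrite qE' (eq_bigl _ _ none) big_pred0_eq addr0 memvZ ?memv_line.
  have pS : tV a \in (\sum_(k' | k' != k) segre_generator tV a k')%VS.
    apply: (subvP (sumv_sup k' kk' (subvv _))).
    by rewrite -[X in tV X](dfwith_id a k') mem_segre_generator.
  rewrite lineE subv_add -!memvE pS qE' memvD // ?memvZ // memv_suml // => l lk.
  by rewrite memvZ // (subvP (sumv_sup l lk (subvv _))) // mem_segre_generator.
have sE : \sum_k turned a k = q + (\sum_k c k) *: tV a.
  rewrite qE addrAC addF2 add0r.
  by apply: eq_bigr => k _; rewrite d1 scale1r.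
have sA : \sum_k turned a k \in A by rewrite sE memvD // memvZ.
rewrite (line_span dimA p0 pA sA) //; apply: contra qp => sp.
have -> : q = \sum_k turned a k + (\sum_k c k) *: tV a.
  by rewrite sE -addrA addF2 addr0.
by rewrite memvD // memvZ // memv_line.
Qed.

(** The component of the pure tensor of [a] in one of the two parity
    subspaces. *)
Definition parity_part a e : TW :=
  \sum_i (if odd_index i == e then chi i (fun k => zc (a k)) else 0) *: U i.

Lemma parity_part_coord a e i : g i (parity_part a e) =
  if odd_index i == e then chi i (fun k => zc (a k)) else 0.
Proof. exact: frame_sum. Qed.

Lemma tensor_parity_parts a : j (tV a) = parity_part a false + parity_part a true.
Proof.
apply: (frame_inj frameU) => i; rewrite linearD /= !parity_part_coord tensor_coord.
by case: (odd_index i); rewrite ?addr0 ?add0r.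
Qed.

(** Multiplying the [k]-th coordinate by [w] multiplies [chi i] by [twist (i
    k) w = w + i_k], and these factors sum to [m w + |i|]. *)
Lemma turned_coord a i :
  g i (j (\sum_k turned a k)) =
  chi i (fun k => zc (a k)) * (m%:R * w + (odd_index i)%:R).
Proof.
rewrite (base_linear_sum lin_j) linear_sum /=.
have -> : m%:R * w + (odd_index i)%:R = \sum_k twist (i k) w.
  (* In characteristic 2 the sum of the entries of [i] is its parity. *)
  rewrite (eq_bigr (fun k => w + (i k)%:R)) => [|k _]; last exact: twist_omega.
  rewrite big_split sumr_const card_ord mulr_natl; congr (_ + _).
  rewrite odd_index_sum; apply: (big_morph (fun b : bool => b%:R : F4)) => // b b'.
  by case: b b' => -[]; rewrite /= ?addF4 ?addr0 ?add0r.
rewrite mulr_sumr; apply: eq_bigr => k _.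
rewrite /turned tensor_coord -chi_point -chiM; apply: eq_bigr => k' _; congr twist.
rewrite /point_at; case: dfwithP => [|k'' kk'']; first by rewrite eqxx ziK mulrC.
by rewrite eq_sym (negPf kk'') mulr1.
Qed.

Lemma turned_parity_parts a :
  j (\sum_k turned a k) = (m%:R * w) *: j (tV a) + parity_part a true.
Proof.
apply: (frame_inj frameU) => i; rewrite linearD linearZ /= parity_part_coord.
rewrite turned_coord tensor_coord mulrDr mulrC; congr (_ + _).
by case: (odd_index i); rewrite ?mulr1 ?mulr0.
Qed.

(** By [turned_coord] the second generator of the line is [m w] times the
    first one plus its odd part. *)
Lemma extended_distinguished_tangent A : distinguished_tangent tV A ->
  exists2 a, forall k, a k != 0 &
    extend_vspace j A = (<[parity_part a false]> + <[parity_part a true]>)%VS.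
Proof.
case/distinguished_tangent_span=> a a0 ->; exists a => //.
rewrite (extend_vspace_pair _ _ lin_j) turned_parity_parts tensor_parity_parts.
set x := parity_part a false; set y := parity_part a true; set c := _ * w.
apply/eqP; rewrite eqEsubv !subv_add -!memvE.
have xS (v v' : TW) : v \in (<[v]> + <[v']>)%VS by apply: (subvP (addvSl _ _)); apply: memv_line.
have yS (v v' : TW) : v' \in (<[v]> + <[v']>)%VS by apply: (subvP (addvSr _ _)); apply: memv_line.
rewrite !memvD ?memvZ ?memvD //=.
set B := (_ + _)%VS.
have pB : x + y \in B by apply: xS.
have qB : c *: (x + y) + y \in B by apply: yS.
have yB : y \in B.
  have -> : y = c *: (x + y) + y - c *: (x + y) by rewrite addrAC subrr add0r.
  by rewrite memvB // memvZ.
rewrite yB andbT; have -> : x = x + y - y by rewrite addrK.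
by rewrite memvB.
Qed.

(** Both parity parts are nonzero, all coefficients of a pure tensor being
    nonzero and both parities occurring; so a combination of them lies in one
    parity subspace only if the other part has the coefficient 0. *)
Lemma parity_parts_meet a e : (forall k, a k != 0) ->
  meets_at_one_point (<[parity_part a false]> + <[parity_part a true]>)%VS (parity_span e).
Proof.
move=> a0; have chi0 i := chi_neq0 i (nonvanishing_zc a0).
have part0 e' : parity_part a e' != 0.
  have [i ie] := odd_index_exists e'; apply/negP => /eqP p0.
  by have := parity_part_coord a e' i; rewrite p0 linear0 ie eqxx => /esym/eqP/idPn[].
have inS : parity_part a e \in parity_span e.
  apply/(mem_cspan frameU) => i ie.
  by rewrite parity_part_coord (negPf ie).
apply: (meets_at_one_point_line (part0 e)); apply/eqP; rewrite eqEsubv; apply/andP; split.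
  apply/subvP => y /memv_capP[/memv_addP[y1 /vlineP[c ->] [y2 /vlineP[d ->] ->]]].
  move/(mem_cspan frameU); have [i ie] := odd_index_exists (~~ e).
  move/(_ i); rewrite linearD !linearZ /= !parity_part_coord ie.
  case: e {inS ie} => //= => /(_ isT) /eqP.
    rewrite [X in _ + X]mulr0 addr0 mulf_eq0 (negPf (chi0 i)) orbF => /eqP ->.
    by rewrite scale0r add0r memvZ ?memv_line.
  rewrite [X in X + _]mulr0 add0r mulf_eq0 (negPf (chi0 i)) orbF => /eqP ->.
  by rewrite scale0r addr0 memvZ ?memv_line.
rewrite -memvE memv_cap inS andbT; case: e {inS}.
  by apply: (subvP (addvSr _ _)); apply: memv_line.
by apply: (subvP (addvSl _ _)); apply: memv_line.
Qed.

Lemma segre_group_parity_union :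
  is_invariant (segre_group tV j) (points_union [:: parity_span false; parity_span true]).
Proof.
apply: invariant_points_union => [|F A GF As]; first exact: segre_group_ker.
have [e0 FE] := segre_group_parity_span GF.
have mem e : parity_span e \in [:: parity_span false; parity_span true].
  by case: e; rewrite !inE eqxx ?orbT.
have [e ->] : exists e, A = parity_span e.
  by move: As; rewrite !inE => /orP[] /eqP ->; [exists false | exists true].
by rewrite FE mem.
Qed.

Lemma parity_span_skew : skew_subspaces (parity_span false) (parity_span true).
Proof.
rewrite /skew_subspaces (cspan_cap frameU); apply: cspan_pred0 => i /=.
by case: (odd_index i).
Qed.

Lemma segre_group_lines_union : is_invariant (segre_group tV j) (points_union pair_lines).
Proof.
apply: invariant_points_union => [|F A]; first exact: segre_group_ker.
exact: segre_group_pair_lines.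
Qed.

Lemma parity_span_conjugate e : conjugate_subspaces cconj
  (parity_span e) (parity_span (e (+) odd m)).
Proof.
apply: conjugate_cspan => i; rewrite odd_index_opposite.
by case: (odd_index i) (odd m) e => [] [] [].
Qed.

Lemma pair_line_real i : is_real cconj (pair_line i).
Proof.
apply: conjugate_cspan => l; rewrite /opposite_pair /= -{3}[i]oppositeK.
by rewrite !(inj_eq (can_inj oppositeK)) orbC.
Qed.

Lemma pair_line_in_parity_span i e : ~~ odd m ->
  (pair_line i <= parity_span e)%VS = (odd_index i == e).
Proof.
move=> em; apply/idP/eqP => [sub|ie].
  have : U i \in pair_line i by rewrite (mem_cspan_frame frameU) /opposite_pair /= eqxx.
  by move/(subvP sub); rewrite (mem_cspan_frame frameU) => /eqP.
apply: (cspanS frameU) => l /orP[] /eqP ->; first by rewrite ie.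
by rewrite odd_index_opposite (negPf em) addbF ie.
Qed.

Lemma pair_line_meets_parity_span i e : odd m ->
  meets_at_one_point (pair_line i) (parity_span e).
Proof.
move=> om; apply: (cspan_meets frameU (i := if odd_index i == e then i else opposite i)) => l.
rewrite /opposite_pair /=.
have [->|li] /= := eqVneq l i.
  by case: eqP => _; rewrite ?eqxx // (negPf (opposite_neq i)).
have [->|lo] /= := eqVneq l (opposite i).
  have oi : opposite i == i = false by rewrite eq_sym (negPf (opposite_neq i)).
  by rewrite odd_index_opposite om addbT; case: (odd_index i) e => -[] /=; rewrite ?eqxx ?oi.
by case: ifP; rewrite ?(negPf li) ?(negPf lo).
Qed.

End InvariantFrame.

(** * The coordinate of a binary plane in the field of four elements *)

Section LocalCoordinate.
Variables (F4 : fieldExtType 'F_2) (w : F4).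
Hypotheses (hF4 : \dim {: F4} = 2%N) (hw : w ^+ 2 + w + 1 = 0).
Variables (V : vectType 'F_2) (e0 e1 : V) (c : bool -> 'Hom(V, ('F_2)^o)).
Hypothesis frame_e : dual_frame (fun b : bool => if b then e1 else e0) c.

(** The scalars are chosen so that [zcoord_e1] and [zcoord_e0] agree with the
    expansions e_1 = u_0 + u_1 and e_0 = w^2 u_0 + w u_1. *)
Definition zcoord (v : V) : F4 := (c false v)%:A * w ^+ 2 + (c true v)%:A.

(** The four values of [zcoord] read backwards; the last branch is that of [w
    ^+ 2]. *)
Definition zvec (z : F4) : V :=
  if z == 0 then 0 else if z == 1 then e1 else if z == w then e0 + e1 else e0.

Lemma vector_cases (v : V) : [\/ v = 0, v = e0, v = e1 | v = e0 + e1].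
Proof.
have [_ expand] := frame_e; rewrite (expand v) big_bool /=.
have [->|->] := F2_cases (c true v); have [->|->] := F2_cases (c false v);
  rewrite ?scale0r ?scale1r ?add0r ?addr0.
- exact: Or41.
- exact: Or42.
- exact: Or43.
by rewrite addrC; apply: Or44.
Qed.

Lemma zcoordD x y : zcoord (x + y) = zcoord x + zcoord y.
Proof. by rewrite /zcoord !linearD /= !scalerDl mulrDl addrACA. Qed.

Lemma zcoord_e0 : zcoord e0 = w ^+ 2.
Proof.
have [dual _] := frame_e.
by rewrite /zcoord (dual false false) (dual true false) /= scale1r scale0r mul1r addr0.
Qed.

Lemma zcoord_e1 : zcoord e1 = 1.
Proof.
have [dual _] := frame_e.
by rewrite /zcoord (dual false true) (dual true true) /= scale1r scale0r mul0r add0r.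
Qed.

Lemma zcoord0 : zcoord 0 = 0.
Proof. by rewrite /zcoord !linear0 !scale0r mul0r addr0. Qed.

Lemma zcoord_e01 : zcoord (e0 + e1) = w.
Proof. by rewrite zcoordD zcoord_e0 zcoord_e1 (omega_sqr hw) -addrA addF4 addr0. Qed.

Lemma zcoordK : cancel zcoord zvec.
Proof.
move=> v; have w0 := omega_neq0 hw; have w1 := omega_neq1 hw.
have w21 := omega_sqr_neq1 hw; have w20 : w ^+ 2 != 0 by rewrite expf_neq0.
have [->|->|->|->] := vector_cases v;
  rewrite ?zcoord0 ?zcoord_e0 ?zcoord_e1 ?zcoord_e01 /zvec ?eqxx //.
- by rewrite (negPf w20) (negPf w21) eq_sym (omega_neq_sqr hw).
- by rewrite oner_eq0.
by rewrite (negPf w0) (negPf w1).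
Qed.

Lemma zvecK : cancel zvec zcoord.
Proof.
move=> z; rewrite /zvec; case: eqP => [->|z0]; first exact: zcoord0.
case: eqP => [->|z1]; first exact: zcoord_e1.
case: eqP => [->|zw]; first exact: zcoord_e01.
by rewrite zcoord_e0; have [] := F4_cases hF4 hw z.
Qed.

Variables (W : vectType F4) (iota : V -> W).
Hypothesis ext_iota : is_scalar_extension iota.

(** The form dual to u_b is the extension of the [b]-th twist of [zcoord]. *)
Lemma omega_frame :
  exists2 g : bool -> 'Hom(W, F4^o),
    dual_frame (fun b => iota e0 + (if b then w ^+ 2 else w) *: iota e1) g &
    forall b v, g b (iota v) = twist b (zcoord v).
Proof.
have [lin_iota _] := ext_iota.
apply: scalar_extension_frame => // [b a x y|v|g hg b b'].
- have [->|->] := F2_cases a; first by rewrite !scale0r !add0r.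
  by rewrite !scale1r zcoordD twistD.
- rewrite big_bool /= !scalerDr addrACA !scalerA -!scalerDl.
  have w4 := expF4_4 hF4 hw w; have w3 := omega3 hw.
  have ws : w ^+ 2 + w = 1 by rewrite (omega_sqr hw) addrAC addF4 add0r.
  have ws' : w + w ^+ 2 = 1 by rewrite addrC.
  have w3' : w * w ^+ 2 = 1 by rewrite mulrC.
  have [->|->|->|->] := vector_cases v; rewrite ?zcoord0 ?zcoord_e0 ?zcoord_e1 ?zcoord_e01.
  + by rewrite (base_linear0 lin_iota) expr0n !mul0r !addr0 !scale0r addr0.
  + by rewrite w4 w3 w3' ws' addF4 scale1r scale0r addr0.
  + by rewrite expr1n !mul1r addF4 ws scale1r scale0r add0r.
  by rewrite -!expr2 w4 ws ws' !scale1r (base_linearD lin_iota).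
rewrite linearD linearZ /= !hg zcoord_e0 zcoord_e1 twist1 [X in _ + X]mulr1.
rewrite -[if b' then _ else _]/(twist b' w) -[w ^+ 2]/(twist true w).
rewrite (twist_twist hF4 hw) !twist_omega // addrACA addF4 add0r.
by case: b b' => -[] //=; rewrite ?addF4 ?add0r ?addr0.
Qed.

Lemma real_frame : exists g : bool -> 'Hom(W, F4^o),
  dual_frame (fun b : bool => iota (if b then e1 else e0)) g.
Proof.
have [lin_iota _] := ext_iota; have [dual expand] := frame_e.
have [|v|g hg b b'|g frame_g _] :=
    scalar_extension_frame (u := fun b : bool => iota (if b then e1 else e0))
      ext_iota (phi := fun b v => (c b v)%:A); last by exists g.
- move=> b a x y.
  have [->|->] := F2_cases a; first by rewrite !scale0r !add0r.
  by rewrite !scale1r linearD scalerDl.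
- rewrite {1}(expand v) (base_linear_sum lin_iota).
  by apply: eq_bigr => b _; rewrite (base_linearZ lin_iota).
by rewrite hg dual; case: eqP => _; rewrite ?scale1r ?scale0r.
Qed.

End LocalCoordinate.

(** * The theorem *)

Lemma cspan_seq (K : fieldType) (I : finType) (T : vectType K) (u : I -> T) (P : pred I) :
  (\sum_(p <- [seq <[u i]>%VS | i <- enum I & P i]) p)%VS = cspan u P.
Proof. by rewrite big_map big_filter big_enum_cond. Qed.

Theorem theorem4
    (m : nat) (hm : (0 < m)%N)
    (F4 : fieldExtType 'F_2) (hF4 : \dim {: F4} = 2%N)
    (w : F4) (hw : w ^+ 2 + w + 1 = 0)
    (V : 'I_m -> vectType 'F_2) (hV : forall k, \dim {: V k} = 2%N)
    (W : 'I_m -> vectType F4) (iota : forall k, V k -> W k)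
    (hW : forall k, is_scalar_extension (iota k))
    (TV : vectType 'F_2) (tV : (forall k, V k) -> TV)
    (hTV : is_tensor_product tV)
    (TW : vectType F4) (tW : (forall k, W k) -> TW)
    (hTW : is_tensor_product tW)
    (j : TV -> TW) (hj : is_tensor_embedding iota tV tW j)
    (cconj : TW -> TW) (hconj : is_conjugation j cconj)
    (e0 e1 : forall k, V k)
    (he : forall k, basis_of {: V k} [:: e0 k; e1 k]) :
  let G := segre_group tV j in
  let Bplus := span_plus w iota e0 e1 tW in
  let Bminus := span_minus w iota e0 e1 tW in
  let lines := opposite_lines w iota e0 e1 tW (Ordinal hm) in
  let real_points_on_lines p := real_point j p /\ points_union lines p in
  [/\ skew_subspaces Bplus Bminus /\ is_invariant G (points_union [:: Bplus; Bminus]),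
      [/\ uniq lines /\ size lines = (2 ^ m.-1)%N,
          forall l, l \in lines -> is_line l /\ is_real cconj l,
          forall l1 l2, l1 \in lines -> l2 \in lines -> l1 != l2 ->
            skew_subspaces l1 l2,
          is_invariant G (points_union lines)
        & has_size real_points_on_lines (3 * 2 ^ m.-1)%N /\
          is_orbit G real_points_on_lines],
      ~~ odd m ->
        [/\ is_real cconj Bplus, is_real cconj Bminus
          & forall l, l \in lines -> (l <= Bplus)%VS (+) (l <= Bminus)%VS],
      odd m ->
        conjugate_subspaces cconj Bplus Bminus /\
        (forall l, l \in lines ->
          meets_at_one_point l Bplus /\ meets_at_one_point l Bminus)
    & forall l, distinguished_tangent tV l ->
        meets_at_one_point (extend_vspace j l) Bplus /\
        meets_at_one_point (extend_vspace j l) Bminus].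
Proof.
(* The frames of the factors induce one frame of [TV] and two frames of [TW].
   *)
pose e (k : 'I_m) (b : bool) := if b then e1 k else e0 k.
have /fin_all_exists[c frame_e] k :
    exists c : bool -> 'Hom(V k, ('F_2)^o), dual_frame (e k) c.
  exact: basis_frame (he k).
pose zc k := zcoord w (c k); pose zi k := zvec w (e0 k) (e1 k).
have zcK k : cancel (zc k) (zi k) := zcoordK hw (frame_e k).
have ziK k : cancel (zi k) (zc k) := zvecK hF4 hw (frame_e k).
have zcD k x y : zc k (x + y) = zc k x + zc k y := zcoordD _ _ _ _.
have [gE frameE _] := tensor_frame hTV frame_e.
have /fin_all_exists2[cU frame_u cUE] k := omega_frame hF4 hw (frame_e k) (hW k).
have /fin_all_exists[cR frame_r] k := real_frame (frame_e k) (hW k).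
have [g frameU gE'] := tensor_frame hTW frame_u.
have [gR frameR _] := tensor_frame hTW frame_r.
have [lin_j jE] := hj.
have {}frameR : dual_frame (fun l : mindex m => j (tV (fun k => e k (l k)))) gR.
  rewrite (_ : (fun l => _) = fun l : mindex m => tW (fun k => iota k (e k (l k)))) //.
  by apply: functional_extensionality => l; rewrite jE.
have tensor_coord (i : mindex m) a : g i (j (tV a)) = chi i (fun k => zc k (a k)).
  by rewrite jE gE'; apply: eq_bigr => k _; rewrite cUE.
have E_tensor (l : mindex m) : exists a, tV (fun k => e k (l k)) = tV a.
  by exists (fun k => e k (l k)).
pose U := U_vec w iota e0 e1 tW.
have {}frameU : dual_frame U g by [].
pose k1 := Ordinal hm.
move=> G Bplus Bminus lines rpl.
have BplusE : Bplus = parity_span U false.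
  by rewrite /Bplus /span_plus cspan_seq; apply: eq_cspan => i; case: odd_index.
have BminusE : Bminus = parity_span U true.
  by rewrite /Bminus /span_minus cspan_seq; apply: eq_cspan => i; case: odd_index.
have linesE : lines = pair_lines k1 U.
  apply: eq_map => i; rewrite /pair_line /opposite_pair cspan_pred2 //.
  exact: opposite_neq k1 i.
have linesP A : A \in lines -> exists2 i : mindex m, ~~ i k1 & A = pair_line U i.
  by rewrite linesE; apply: pair_linesP.
have size_lines : size lines = (2 ^ m.-1)%N by rewrite linesE size_pair_lines.
have inv_lines : is_invariant G (points_union lines).
  rewrite linesE.
  exact: (segre_group_lines_union hF4 hw k1 lin_j zcK ziK zcD frameU tensor_coord).
rewrite BplusE BminusE.
have conj_span b :
    conjugate_subspaces cconj (parity_span U b) (parity_span U (b (+) odd m)).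
  exact: (parity_span_conjugate hF4 hw E_tensor frameR frameU tensor_coord hconj).
split.
- split; first exact: (parity_span_skew frameU).
  exact: (segre_group_parity_union hF4 hw lin_j zcK ziK zcD frameU tensor_coord).
- split=> //.
  + by split; rewrite // linesE; apply: (uniq_pair_lines k1 frameU).
  + move=> A /linesP[i _ ->]; split; first exact: (dim_cspan_pred2 frameU (opposite_neq k1 i)).
    exact: (pair_line_real hF4 hw E_tensor frameR frameU tensor_coord hconj).
  + by move=> A B; rewrite linesE; apply: (pair_lines_skew frameU).
  split.
    rewrite -size_lines /rpl linesE.
    exact: (real_points_size hF4 hw k1 lin_j E_tensor frameR frameU tensor_coord hconj).
  rewrite /rpl linesE; apply: (real_points_orbit hF4 hw hTV lin_j zcK ziK zcD frameE
    E_tensor frameR frameU tensor_coord hconj).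
  by rewrite -linesE.
- move=> em; have := conj_span; rewrite (negPf em) => real.
  split; [exact: (real false) | exact: (real true) |].
  move=> A /linesP[i _ ->]; rewrite !(pair_line_in_parity_span frameU) //.
  by case: odd_index.
- move=> om; split; first by have := conj_span false; rewrite om.
  by move=> A /linesP[i _ ->]; split; apply: (pair_line_meets_parity_span k1 frameU).
move=> A dA.
have [a a0 ->] : exists2 a, forall k, a k != 0 & extend_vspace j A =
    (<[parity_part zc U a false]> + <[parity_part zc U a true]>)%VS.
  exact: (extended_distinguished_tangent hF4 hw hTV lin_j zcK ziK zcD frameU
    tensor_coord).
by split; apply: (parity_parts_meet k1 zcK zcD frameU).
Qed.
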